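(* Let $K\subset\mathbb R^2$ be a triangle and let $k\ge 3$, $\ell\ge k-1$ be integers. Then the following degrees of freedom are unisolvent for $\boldsymbol\Sigma_{\ell,k}(K)=\mathbb C_\ell(K;\mathbb S)\oplus\mathbb C_k^{\oplus}(K;\mathbb S)$: (1) $\boldsymbol\tau(\delta)$ for all vertices $\delta\in\mathcal V(K)$; (2) $(\boldsymbol n^{\intercal}\boldsymbol\tau\boldsymbol n,q)_e$ for all $q\in\mathbb P_{\ell-2}(e)$, $e\in\mathcal E(K)$; (3) $(\partial_t(\boldsymbol t^{\intercal}\boldsymbol\tau\boldsymbol n)+\boldsymbol n^{\intercal}\operatorname{div}\boldsymbol\tau,q)_e$ for all $q\in\mathbb P_{\ell-1}(e)$, $e\in\mathcal E(K)$; (4) $(\boldsymbol\tau,\boldsymbol\varsigma)_K$ for all $\boldsymbol\varsigma\in\nabla^2\mathbb P_{k-2}(K)\oplus\operatorname{sym}(\boldsymbol x^{\perp}\otimes\mathbb P_{\ell-2}(K;\mathbb R^2))$. That is, the number of these degrees of freedom (counted with bases of the test spaces) equals $\dim\boldsymbol\Sigma_{\ell,k}(K)$, and any $\boldsymbol\tau\in\boldsymbol\Sigma_{\ell,k}(K)$ for which all of them vanish is zero.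
   Context: $\mathbb S$ is the space of symmetric real $2\times2$ matrices; $\mathbb P_m(G;\mathbb X)$ is the space of $\mathbb X$-valued polynomials of total degree at most $m$ on $G$ (with $\mathbb P_m(G)=\mathbb P_m(G;\mathbb R)$). Coordinates $\boldsymbol x=(x_1,x_2)^{\intercal}$ are taken with origin at a point of $K$, and $\boldsymbol x^{\perp}=(x_2,-x_1)^{\intercal}$. $\operatorname{sym}A=(A+A^{\intercal})/2$, $\boldsymbol a\otimes\boldsymbol b=\boldsymbol a\boldsymbol b^{\intercal}$. For scalar $\phi$, $\operatorname{curl}\phi=(\partial_{x_2}\phi,-\partial_{x_1}\phi)^{\intercal}$; $\operatorname{curl}$ of a vector field is the matrix obtained row-wise, and $\operatorname{div}$ of a matrix field is the vector obtained row-wise. $\nabla^2$ is the Hessian. $\mathbb C_\ell(K;\mathbb S)=\operatorname{sym}\operatorname{curl}\mathbb P_{\ell+1}(K;\mathbb R^2)$ and $\mathbb C_k^{\oplus}(K;\mathbb S)=\{q\,\boldsymbol x\boldsymbol x^{\intercal}:q\in\mathbb P_{k-2}(K)\}$. $\mathcal V(K)$, $\mathcal E(K)$ are the sets of vertices and edges of $K$; $\boldsymbol n=(n_1,n_2)^{\intercal}$ is the unit outward normal on $\partial K$, $\boldsymbol t=(-n_2,n_1)^{\intercal}$, $\partial_t$ is the derivative along $\boldsymbol t$; $(\cdot,\cdot)_e$, $(\cdot,\cdot)_K$ are $L^2$ inner products (Frobenius product for matrices). *)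

(* Defs.v *)
From HB Require Import structures.
From mathcomp Require Import all_boot all_order all_algebra.
From mathcomp Require Import all_classical all_reals all_analysis.
(* The notations of [mpoly] clash with those of analysis. *)
From mathcomp Require Import -(notations) mpoly.

Set Implicit Arguments.
Unset Strict Implicit.
Unset Printing Implicit Defensive.

Import Order.TTheory GRing.Theory Num.Theory.
Import numFieldNormedType.Exports.

Local Open Scope classical_set_scope.
Local Open Scope ring_scope.

Definition has_dim (R : realType) (V : lmodType R) (A : set V) (d : nat) : Prop :=
  exists b : 'I_d -> V,
    (forall c : 'I_d -> R, \sum_i c i *: b i = 0 -> forall i, c i = 0) /\
    A = [set \sum_i c i *: b i | c in [set: 'I_d -> R]].

Definition sum_space (V : zmodType) (A B : set V) : set V :=
  [set u + v | u in A & v in B].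

Definition direct_sum (V : zmodType) (A B : set V) : Prop := A `&` B = [set 0].

Section Plane.
Variable R : realType.

Local Notation E := 'cV[R]_2.
Local Notation sfield := (E -> R).
Local Notation vfield := (E -> E).
Local Notation mfield := (E -> 'M[R]_2).

(* The Euclidean inner product; note that the library norm [`|x|] on matrices
   is the max norm, so Euclidean lengths are written with [dot]. *)
Definition dot (x y : E) : R := (x^T *m y) 0 0.

Definition perp (x : E) : E := \col_i (if i == 0 then x 1 0 else - x 0 0).

(* The tangent (-n2, n1) associated with a normal (n1, n2). *)
Definition tangent (n : E) : E := - perp n.

Definition sym (A : 'M[R]_2) : 'M[R]_2 := 2^-1 *: (A + A^T).

Definition Symmetric : set 'M[R]_2 := [set A | A^T = A].

Definition partial (i : 'I_2) (f : sfield) : sfield := fun x => 'D_(delta_mx i 0) f x.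

Definition curl (f : sfield) : vfield :=
  fun x => \col_i (if i == 0 then partial 1 f x else - partial 0 f x).

Definition curlv (v : vfield) : mfield :=
  fun x => \matrix_(i, j) curl (fun y => v y i 0) x j 0.

Definition div (t : mfield) : vfield :=
  fun x => \col_i \sum_j partial j (fun y => t y i j) x.

Definition hessian (q : sfield) : mfield :=
  fun x => \matrix_(i, j) partial i (partial j q) x.

(* Polynomial functions of total degree at most [m]
   ([msize] is the total degree plus one, and 0 for the zero polynomial).
   As a triangle has nonempty interior, polynomials on it are identified with
   polynomial functions on the whole plane. *)
Definition polys (m : nat) : set sfield :=
  [set f | exists2 p : mpoly.mpoly 2 R, (mpoly.msize p <= m.+1)%N &
     f = fun x : E => mpoly.meval (fun i => x i 0) p].

Definition vpolys (m : nat) : set vfield :=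
  [set v | forall i, polys m (fun x => v x i 0)].

(* Polynomials on a set G: restrictions to G, extended by 0 outside G, so that
   two polynomials that agree on G are the same element. *)
Definition polys_on (G : set E) (m : nat) : set sfield := [set f \_ G | f in polys m].

Definition Cspace (l : nat) : set mfield :=
  [set (fun x => sym (curlv v x)) | v in vpolys l.+1].

(* In the spaces that involve the coordinate vector, coordinates are taken with
   origin at [o], i.e. the position vector x of the paper is [x - o]. *)
Definition Ccompl (o : E) (k : nat) : set mfield :=
  [set (fun x => q x *: ((x - o) *m (x - o)^T)) | q in polys (k - 2)].

Definition Sigma (o : E) (l k : nat) : set mfield := sum_space (Cspace l) (Ccompl o k).

Definition hessP (m : nat) : set mfield := [set hessian q | q in polys m].

Definition symperpP (o : E) (m : nat) : set mfield :=
  [set (fun x => sym (perp (x - o) *m (v x)^T)) | v in vpolys m].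

Definition noncollinear (a : 'I_3 -> E) : Prop :=
  \det (row_mx (a 1 - a 0) (a 2 - a 0) : 'M[R]_(2, 1 + 1)) != 0.

Definition triangle (a : 'I_3 -> E) : set E :=
  [set x | exists w : 'I_3 -> R,
     [/\ forall i, 0 <= w i, \sum_i w i = 1 & x = \sum_i w i *: a i]].

(* Edge [e] is the one opposite to the vertex [a e]. *)
Definition edge_param (a : 'I_3 -> E) (e : 'I_3) (s : R) : E :=
  (1 - s) *: a (ordS e) + s *: a (ord_pred e).

Definition edge (a : 'I_3 -> E) (e : 'I_3) : set E :=
  [set edge_param a e s | s in `[0, 1]].

Definition edge_vec (a : 'I_3 -> E) (e : 'I_3) : E := a (ord_pred e) - a (ordS e).

Definition outward_unit_normal (a : 'I_3 -> E) (e : 'I_3) (n : E) : Prop :=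
  [/\ dot n n = 1, dot n (edge_vec a e) = 0 & dot n (a e - a (ordS e)) < 0].

(* The arc-length L2 product, through the constant-speed parametrization. *)
Definition ip_edge (a : 'I_3 -> E) (e : 'I_3) (f g : sfield) : R :=
  Num.sqrt (dot (edge_vec a e) (edge_vec a e)) *
  \int[lebesgue_measure]_(s in `[0, 1]) (f (edge_param a e s) * g (edge_param a e s)).

Definition frob (A B : 'M[R]_2) : R := \sum_i \sum_j A i j * B i j.

Definition point_of (z : R * R) : E := \col_i (if i == 0 then z.1 else z.2).

Definition ip_triangle (a : 'I_3 -> E) (t u : mfield) : R :=
  \int[(lebesgue_measure \x lebesgue_measure)%E]_(z in point_of @^-1` triangle a)
    frob (t (point_of z)) (u (point_of z)).

(* For an edge with unit normal [n]: n^T tau n, and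
   d_t(t^T tau n) + n^T div tau. *)
Definition nn_trace (n : E) (t : mfield) : sfield := fun x => (n^T *m t x *m n) 0 0.

Definition edge_trace (n : E) (tau : mfield) : sfield :=
  fun x => 'D_(tangent n) (fun y => ((tangent n)^T *m tau y *m n) 0 0) x
           + (n^T *m div tau x) 0 0.

End Plane.

(* Main.v *)
(* In the coordinates x - o, every field of Sigma is sym curl v + q x x^T, and
   div div (sym curl v) = 0 while div div (q x x^T) = (D + 3)(D + 2) q with D the
   Euler operator, whose eigenvectors are the homogeneous polynomials; hence the
   sum is direct.  In the same way x^T (hess q) x = D (D - 1) q while
   x^T sym(x^perp (x) v) x = 0.  The dimensions are counted with monomials, after
   removing the kernels RT = {c x + b} of sym curl and P_1 of the Hessian.

   Let all degrees of freedom of tau vanish.  On an edge, n^T tau n has degree at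
   most l (as x . n is constant there) and the second trace has degree at most
   l - 1, so both traces vanish.  Integration by parts then gives
   (div div tau, p) = (tau, hess p) = 0 for p of degree at most k - 2, and q = 0.
   For tau = sym curl v the traces are d_t (v . n) and d_t^2 (v . t); together with
   tau = 0 at the vertices they force v, modulo RT, to vanish on all edges, so that
   v = lam_0 lam_1 lam_2 w.  Since rot maps sym(x^perp (x) P_(l-2)) onto P_(l-2),
   some test field yields (v, w) = 0, that is w = 0. *)
From HB Require Import structures.
Require Import Defs.
From mathcomp Require Import all_boot all_order all_algebra.
From mathcomp Require Import all_classical all_reals all_analysis.
From mathcomp Require Import measurable_realfun.
From mathcomp Require Import -(notations) mpoly.
From mathcomp Require Import ring lra zify.

Set Implicit Arguments.
Unset Strict Implicit.
Unset Printing Implicit Defensive.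

Import Order.TTheory GRing.Theory Num.Theory.
Import numFieldNormedType.Exports.
Local Open Scope classical_set_scope.
Local Open Scope ring_scope.

(** * Polynomial functions on the plane *)

(** Derivatives, degrees and pointwise identities are settled formally in the polynomial ring, in
    the variables x - o; on an edge every quantity is a univariate polynomial in the parameter. Only
    polynomials are integrated: an affine substitution carries the triangle to the reference
    triangle, where integrating first along one side reduces the divergence theorem to the
    fundamental theorem of calculus. The obstacle is that the two traces do not give v on the edges
    but only its derivatives: v . n up to a constant and v . t up to an affine function, edge by
    edge. The vertex values do the gluing. Once q = 0, they make grad v a multiple of the identity
    at each vertex; as d_t (v . t) is constant on an edge, the multiples at its two ends agree; with
    the common multiple c, the field v - c x is constant on every edge, with the same value on all
    three since they share vertices. The vertex values also remove the end terms in t^T tau n when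
    the Hessian is integrated by parts. *)

Lemma I2_cases (i : 'I_2) : i = 0 \/ i = 1.
Proof. by case: i => [[|[|?]] ?] //; [left|right]; apply/val_inj. Qed.

Lemma I3_cases (i : 'I_3) : [\/ i = 0, i = 1 | i = 2].
Proof.
by case: i => [[|[|[|?]]] ?] //; [constructor 1|constructor 2|constructor 3]; apply/val_inj.
Qed.

Lemma sum_I2 (V : nmodType) (F : 'I_2 -> V) : \sum_i F i = F 0 + F 1.
Proof. by rewrite big_ord_recl big_ord1; congr (_ + F _); apply/val_inj. Qed.

Lemma sum_I3 (V : nmodType) (F : 'I_3 -> V) : \sum_i F i = F 0 + F 1 + F 2.
Proof.
rewrite big_ord_recr big_ord_recr big_ord1 /=.
by congr (F _ + F _ + F _); apply/val_inj.
Qed.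

Section Poly2.
Variable R : realType.
Local Notation MP := (mpoly 2 R).
Local Notation "'x_ i" := (mpolyX R (mnm1 (i : 'I_2))) (at level 8, i at level 2).
Local Notation E := 'cV[R]_2.
Implicit Types p q : MP.

(** Polynomials are generated by constants and variables under sum and product, so facts about
    evaluations and restrictions need checking on these generators only. *)
Lemma mpoly_gen_ind (P : MP -> Prop) :
  (forall c, P (mpolyC 2 c)) -> (forall i, P 'x_i) ->
  (forall p q, P p -> P q -> P (p + q)) ->
  (forall p q, P p -> P q -> P (p * q)) -> forall p, P p.
Proof.
move=> hC hX hD hM p; rewrite (mpolyE p).
have P0 : P 0 by have := hC 0; rewrite mpolyC0.
have P1 : P 1 by exact: hC.
apply: big_ind => //= m _; rewrite -mul_mpolyC; apply: (hM _ _ (hC _)).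
rewrite mpolyXE_id; apply: big_ind => // i _.
by elim: (m i) => [|k ih]; rewrite ?expr0 // exprS; apply: hM.
Qed.

Lemma msize_coefP n p :
  reflect (forall c, (n <= mdeg c)%N -> mcoeff c p = 0) (msize p <= n)%N.
Proof.
apply: (iffP idP) => [sp c nc|h].
  by apply/eqP; rewrite mcoeff_eq0; apply: msize_mdeg_ge; exact: leq_trans nc.
rewrite msizeE; apply/bigmax_leqP_seq => c cp _.
rewrite ltnNge; apply: contraTN cp => nc; rewrite -mcoeff_eq0; exact/eqP/h.
Qed.

Lemma msizeM_leq p q m n : (msize p <= m.+1)%N -> (msize q <= n.+1)%N ->
  (msize (p * q) <= (m + n).+1)%N.
Proof.
move=> sp sq; have [->|p0] := eqVneq p 0; first by rewrite mul0r msize0.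
have [->|q0] := eqVneq q 0; first by rewrite mulr0 msize0.
rewrite msizeM //; move: sp sq; move: (mmeasure _ p) (mmeasure _ q) => a b; lia.
Qed.

Lemma msizeD_leq p q n : (msize p <= n)%N -> (msize q <= n)%N -> (msize (p + q) <= n)%N.
Proof. by move=> sp sq; apply: leq_trans (msizeD_le _ _) _; rewrite geq_max sp. Qed.

Lemma msizeZ_leq c p n : (msize p <= n)%N -> (msize (c *: p) <= n)%N.
Proof. exact/leq_trans/msizeZ_le. Qed.

Lemma msizeB_leq p q n : (msize p <= n)%N -> (msize q <= n)%N -> (msize (p - q) <= n)%N.
Proof. by move=> sp sq; apply: msizeD_leq => //; rewrite msizeN. Qed.

Lemma msize_mderiv i p n : (msize p <= n.+1)%N -> (msize (mderiv i p) <= n)%N.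
Proof.
move/msize_coefP => h; apply/msize_coefP => c nc.
by rewrite mcoeff_mderiv h ?mul0rn // mdegD mdeg1 addn1.
Qed.

Lemma mevalMr (h : 'I_2 -> R) p q : meval h (p * q) = meval h p * meval h q.
Proof. exact: mevalM. Qed.

Lemma msize_comp p (lq : 2.-tuple MP) : (forall i, msize (tnth lq i) <= 2)%N ->
  (msize (comp_mpoly lq p) <= msize p)%N.
Proof.
move=> hl; rewrite {1}(mpolyE p) raddf_sum /=.
rewrite big_seq; apply: (big_ind (fun q => msize q <= msize p)%N); first by rewrite msize0.
  by move=> ? ?; apply: msizeD_leq.
move=> m mp; rewrite linearZ /=; apply: msizeZ_leq.
rewrite comp_mpolyX.
have h i k : (msize (tnth lq i ^+ k) <= k.+1)%N.
  elim: k => [|k ih]; first by rewrite expr0 msize1.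
  by rewrite exprS; apply: (@msizeM_leq _ _ 1 k).
have -> : \prod_(i < 2) tnth lq i ^+ m i = tnth lq 0 ^+ m 0 * tnth lq 1 ^+ m 1.
  by rewrite big_ord_recl big_ord1; congr (_ * tnth _ _ ^+ (m _)); apply/val_inj.
apply: (leq_trans (msizeM_leq (h _ _) (h _ _))).
by have := msize_mdeg_lt mp; rewrite mdegE sum_I2.
Qed.

(** Substituting affine forms for the variables does not raise the degree. With two arbitrary
    coordinate systems [k] and [k'], the lemma serves both to move the origin and to pass to a frame
    and back. *)
Lemma meval_affine (T : Type) (k k' : T -> 'I_2 -> R) (A : 'I_2 -> 'I_2 -> R) (b : 'I_2 -> R) :
  (forall x i, k' x i = b i + A i 0 * k x 0 + A i 1 * k x 1) ->
  forall p, exists2 q, (msize q <= msize p)%N & forall x, meval (k' x) p = meval (k x) q.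
Proof.
move=> kE p.
pose lq := [tuple mpolyC 2 (b i) + A i 0 *: 'x_0 + A i 1 *: 'x_1 | i < 2].
exists (comp_mpoly lq p).
  apply: msize_comp => i; rewrite tnth_mktuple.
  have h j c : (msize (c *: 'x_j) <= 2)%N.
    by apply: msizeZ_leq; rewrite msizeX mdeg1.
  by rewrite !msizeD_leq // msizeC; case: (_ == _).
move=> x; rewrite comp_mpoly_meval; apply: meval_eq => i.
by rewrite tnth_mktuple !mevalD !mevalZ !mevalXU mevalC kE.
Qed.

(** * Polynomials as functions of x - o: derivatives and restrictions to lines *)

Section Ev.
Variable o : E.

Definition ev p : E -> R := fun x => meval (fun i => x i 0 - o i 0) p.

Lemma evD p q x : ev (p + q) x = ev p x + ev q x.
Proof. by rewrite /ev mevalD. Qed.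

Lemma evB p q x : ev (p - q) x = ev p x - ev q x.
Proof. by rewrite /ev mevalB. Qed.

Lemma evN p x : ev (- p) x = - ev p x.
Proof. by rewrite /ev mevalN. Qed.

Lemma evM p q x : ev (p * q) x = ev p x * ev q x.
Proof. by rewrite /ev mevalMr. Qed.

Lemma evC c x : ev (mpolyC 2 c) x = c.
Proof. by rewrite /ev mevalC. Qed.

Lemma evX i x : ev 'x_i x = x i 0 - o i 0.
Proof. by rewrite /ev mevalXU. Qed.

Definition evE := (evD, evN, evM, evC, evX).

Lemma polysP m (f : E -> R) :
  polys m f <-> exists2 p, (msize p <= m.+1)%N & f = ev p.
Proof.
split=> [[p sp ->]|[p sp ->]].
- have [|q sq qE] := @meval_affine E (fun x i => x i 0 - o i 0) (fun x i => x i 0)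
    (fun i j => (i == j)%:R) (fun i => o i 0) _ p.
    by move=> x i; case: (I2_cases i) => -> /=; ring.
  by exists q; [exact: leq_trans sp|apply/funext => x; rewrite qE].
- have [|q sq qE] := @meval_affine E (fun x i => x i 0) (fun x i => x i 0 - o i 0)
    (fun i j => (i == j)%:R) (fun i => - o i 0) _ p.
    by move=> x i; case: (I2_cases i) => -> /=; ring.
  by exists q; [exact: leq_trans sp|apply/funext => x; rewrite /ev qE].
Qed.

Lemma is_derive_coord (x v : E) (i : 'I_2) :
  is_derive x v (fun y : E => y i 0 : R) (v i 0).
Proof.
have h : (fun t : R => t^-1 *: (((fun y : E => y i 0) \o shift x) (t *: v) - x i 0))
    @ 0^' --> (v i 0 : R).
  apply: (@cvg_trans _ ((fun=> v i 0) @ (0 : R)^')); last exact: cvg_cst.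
  apply: near_eq_cvg; near=> t.
  have t0 : t != 0 by near: t; exact: nbhs_dnbhs_neq.
  by rewrite /= !mxE addrK scalerA mulVf // scale1r.
split; first by apply/cvg_ex; exists (v i 0).
exact/cvg_lim.
Unshelve. all: by end_near. Qed.

(* Locked: rewriting with [evD] must not see through the definition. *)
Definition mdirderiv (v : E) p : MP :=
  locked (mpolyC 2 (v 0 0) * mderiv 0 p + mpolyC 2 (v 1 0) * mderiv 1 p).

Lemma mdirderivE v p :
  mdirderiv v p = mpolyC 2 (v 0 0) * mderiv 0 p + mpolyC 2 (v 1 0) * mderiv 1 p.
Proof. by rewrite /mdirderiv -lock. Qed.

Lemma mderivXU i j : mderiv i 'x_j = mpolyC 2 (j == i)%:R :> MP.
Proof.
rewrite mderivX mnm1E; case: eqVneq => [->|_]; last by rewrite scale0r mpolyC0.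
have -> : mnm_sub (mnm1 i) (mnm1 i) = @mnm0 2.
  by apply/mnmP => k; rewrite mnmBE mnm0E subnn.
by rewrite mpolyX0 -mul_mpolyC mulr1.
Qed.

Lemma mdirderivC v c : mdirderiv v (mpolyC 2 c) = 0.
Proof. by rewrite !mdirderivE !mderivC !mulr0 addr0. Qed.

Lemma mdirderivX v i : mdirderiv v 'x_i = mpolyC 2 (v i 0).
Proof.
by rewrite !mdirderivE !mderivXU; case: (I2_cases i) => -> /=;
  rewrite ?mulr1 ?mulr0 ?addr0 ?add0r.
Qed.

Lemma mdirderivD v p q : mdirderiv v (p + q) = mdirderiv v p + mdirderiv v q.
Proof. by rewrite !mdirderivE !mderivD !mulrDr addrACA. Qed.

Lemma mdirderivM v p q : mdirderiv v (p * q) = mdirderiv v p * q + p * mdirderiv v q.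
Proof. rewrite !mdirderivE !mderivM; ring. Qed.

Lemma is_derive_ev (x v : E) p : is_derive x v (ev p) (ev (mdirderiv v p) x).
Proof.
elim/mpoly_gen_ind: p => [c|i|p q hp hq|p q hp hq].
- have -> : ev (mpolyC 2 c) = cst c by apply/funext => y; rewrite evC.
  by apply: is_derive_eq; rewrite mdirderivC -mpolyC0 evC.
- have -> : ev 'x_i = (fun y : E => y i 0 : R) - cst (o i 0).
    by apply/funext => y; rewrite evX.
  have h := is_derive_coord x v i.
  by apply: is_derive_eq; rewrite subr0 mdirderivX evC.
- have -> : ev (p + q) = ev p + ev q by apply/funext => y; rewrite evD.
  by apply: is_derive_eq; rewrite mdirderivD evD.
- have -> : ev (p * q) = ev p * ev q by apply/funext => y; rewrite evM.
  by apply: is_derive_eq; rewrite mdirderivM evD !evM /GRing.scale /=; ring.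
Qed.

Lemma derive_ev (v : E) p x : 'D_v (ev p) x = ev (mdirderiv v p) x.
Proof. by have h := is_derive_ev x v p; rewrite derive_val. Qed.

Lemma partial_ev i p : partial i (ev p) = ev (mderiv i p).
Proof.
apply/funext => x; rewrite /partial derive_ev mdirderivE !mxE; congr (ev _ x).
by case: (I2_cases i) => -> /=; rewrite ?mpolyC1 ?mpolyC0 ?mul1r ?mul0r ?addr0 ?add0r.
Qed.

(** Restriction to the line [b + s *: d] as a formal polynomial in s, so that degrees, roots and
    derivatives along the line are available. *)
Definition restr (b d : E) (p : MP) : {poly R} :=
  locked (mmap (@polyC R) (fun i => (b i 0 - o i 0)%:P + d i 0 *: 'X) p).

Lemma restrD b d : {morph restr b d : p q / p + q}.
Proof. by move=> p q; rewrite /restr -!lock mmapD. Qed.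
Lemma restrM b d : {morph restr b d : p q / p * q}.
Proof. by move=> p q; rewrite /restr -!lock rmorphM. Qed.
Lemma restrC b d c : restr b d (mpolyC 2 c) = c%:P.
Proof. by rewrite /restr -lock mmapC. Qed.
Lemma restrX b d i : restr b d 'x_i = (b i 0 - o i 0)%:P + d i 0 *: 'X.
Proof. by rewrite /restr -lock mmapX mmap1U. Qed.
Lemma restrZ b d c p : restr b d (c *: p) = c *: restr b d p.
Proof. by rewrite -mul_mpolyC restrM restrC mul_polyC. Qed.

Lemma restrB b d p q : restr b d (p - q) = restr b d p - restr b d q.
Proof. by rewrite restrD -[- q]scaleN1r restrZ scaleN1r. Qed.

Lemma horner_restr b d p s : (restr b d p).[s] = ev p (b + s *: d).
Proof.
elim/mpoly_gen_ind: p => [c|i|p q hp hq|p q hp hq].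
- by rewrite restrC evC hornerC.
- by rewrite restrX evX !mxE hornerD hornerC hornerZ hornerX; ring.
- by rewrite restrD evD hornerD hp hq.
- by rewrite restrM evM hornerM hp hq.
Qed.

Lemma deriv_restr b d p : (restr b d p)^`() = restr b d (mdirderiv d p).
Proof.
elim/mpoly_gen_ind: p => [c|i|p q hp hq|p q hp hq].
- by rewrite mdirderivC restrC derivC -mpolyC0 restrC polyC0.
- by rewrite restrX derivD derivC add0r derivZ derivX mdirderivX restrC alg_polyC.
- by rewrite restrD derivD hp hq mdirderivD restrD.
- by rewrite mdirderivM restrM derivM hp hq restrD !restrM.
Qed.

Lemma size_restr b d p : (size (restr b d p) <= msize p)%N.
Proof.
rewrite {1}(mpolyE p) (big_morph _ (@restrD b d) (_ : restr b d 0 = 0)); last first.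
  by rewrite -mpolyC0 restrC polyC0.
rewrite big_seq; apply: (big_ind (fun q : {poly R} => size q <= msize p)%N).
- by rewrite size_poly0.
- by move=> u w hu hw; apply: leq_trans (size_polyD _ _) _; rewrite geq_max hu.
move=> m mp; rewrite restrZ; apply: leq_trans (size_scale_leq _ _) _.
apply: leq_trans (msize_mdeg_lt mp); rewrite mdegE sum_I2.
rewrite mpolyXE_id big_ord_recl big_ord1 restrM.
have -> : lift ord0 ord0 = 1 :> 'I_2 by apply/val_inj.
have h i k : (size (restr b d ('x_i ^+ k)) <= k.+1)%N.
  elim: k => [|k ih]; first by rewrite expr0 -mpolyC1 restrC size_polyC_leq1.
  rewrite exprS restrM restrX; apply: leq_trans (size_polyMleq _ _) _.
  have h2 : (size ((b i 0 - o i 0)%:P + d i 0 *: 'X : {poly R})%R <= 2)%N.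
    apply: leq_trans (size_polyD _ _) _; rewrite geq_max; apply/andP; split.
      by apply: leq_trans (size_polyC_leq1 _) _.
    by apply: leq_trans (size_scale_leq _ _) _; rewrite size_polyX.
  by rewrite -subn1 leq_subLR (leq_trans (leq_add h2 ih)) // add2n.
apply: leq_trans (size_polyMleq _ _) _.
by rewrite -subn1 leq_subLR (leq_trans (leq_add (h 0 (m 0)) (h 1 (m 1)))) // addSn addnS add1n.
Qed.

Lemma poly_eq0_oo (P : {poly R}) : (forall s, 0 < s < 1 -> P.[s] = 0) -> P = 0.
Proof.
move=> h; apply/eqP; apply: contraT => P0.
(* The points 1/2, 1/3, ... of ]0, 1[ give [size P] distinct roots, one more than the degree
   allows. *)
pose rs := [seq ((i.+2)%:R : R)^-1 | i <- iota 0 (size P)].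
have urs : uniq rs.
  rewrite map_inj_uniq ?iota_uniq // => i j /invr_inj /eqP.
  by rewrite eqr_nat => /eqP [].
have : (size rs < size P)%N.
  apply: max_poly_roots => //; apply/allP => _ /mapP[i _ ->]; apply/eqP/h.
  by rewrite invr_gt0 ltr0n /= invf_lt1 ?ltr0n // ltr1n.
by rewrite size_map size_iota ltnn.
Qed.

Lemma ev_center p : ev p o = mcoeff (@mnm0 2) p.
Proof.
elim/mpoly_gen_ind: p => [c|i|p q hp hq|p q hp hq].
- by rewrite evC mcoeffC eqxx mulr1.
- by rewrite evX subrr mcoeffX mnm1_eq0.
- by rewrite evD mcoeffD hp hq.
- by rewrite evM hp hq; have [-> _] := mcoeff0_is_multiplicative 2 R.
Qed.

(** Induction on the degree of the monomial: the constant coefficient is the value at [o], and any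
    other one is, up to a nonzero integer factor, a coefficient of lower degree of a partial
    derivative, which vanishes everywhere too. *)
Lemma ev_eq0 p : (forall x, ev p x = 0) -> p = 0.
Proof.
move=> h; apply/mpolyP => c; rewrite mcoeff0.
have [n le_n] := ubnP (mdeg c); elim: n => // n ih in p h c le_n *.
have [->|c0] := eqVneq c (@mnm0 2); first by rewrite -ev_center h.
have [i ci] : exists i, (0 < c i)%N.
  apply: contra_neqP c0 => /forallNP c0; apply/mnmP => i; rewrite mnm0E.
  by have := c0 i; case: (c i).
have cE : c = mnm_add (mnm_sub c (mnm1 i)) (mnm1 i).
  apply/mnmP => j; rewrite mnmDE mnmBE mnm1E.
  by case: eqVneq => [<-|_]; rewrite ?subnK ?subn0 ?addn0.
have : mcoeff (mnm_sub c (mnm1 i)) (mderiv i p) = 0.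
  apply: ih => [x|].
    rewrite -partial_ev /partial.
    by rewrite (_ : ev p = cst 0) ?derive_cst //; apply/funext.
  by rewrite cE mdegD mdeg1 addn1 ltnS in le_n.
by rewrite mcoeff_mderiv -cE => /eqP; rewrite mulrn_eq0 => /eqP.
Qed.

Lemma ev_inj p q : (forall x, ev p x = ev q x) -> p = q.
Proof.
move=> h; apply/eqP; rewrite -subr_eq0; apply/eqP/ev_eq0 => x.
by rewrite evB h subrr.
Qed.

(** * Affine frames and division by the equation of a line *)

Section Frame.
Variables (b u w : E).
Let D : R := u 0 0 * w 1 0 - u 1 0 * w 0 0.
Hypothesis D0 : D != 0.

Lemma ev_eq0_corner p :
  (forall s r, 0 < s -> 0 < r -> s + r < 1 -> ev p (b + r *: w + s *: u) = 0) -> p = 0.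
Proof.
move=> h.
have h1 r s : 0 < r < 1 -> ev p (b + r *: w + s *: u) = 0.
  move=> /andP[r0 r1].
  (* The direction is scaled by [1 - r] so that the whole parameter interval ]0, 1[ stays inside the
     open corner. *)
  have P0 : restr (b + r *: w) ((1 - r) *: u) p = 0.
    apply: poly_eq0_oo => t /andP[t0 t1]; rewrite horner_restr scalerA.
    by apply: h; rewrite ?mulr_gt0 ?subr_gt0 //; nra.
  have := horner_restr (b + r *: w) ((1 - r) *: u) p (s / (1 - r)).
  by rewrite P0 horner0 scalerA divfK // lt0r_neq0 // subr_gt0.
have h2 r s : ev p (b + s *: u + r *: w) = 0.
  have P0 : restr (b + s *: u) w p = 0.
    by apply: poly_eq0_oo => t t01; rewrite horner_restr addrAC h1.
  by rewrite -horner_restr P0 horner0.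
apply: ev_eq0 => x.
pose y := x - b.
have -> : x = b + ((y 0 0 * w 1 0 - y 1 0 * w 0 0) / D) *: u
               + ((u 0 0 * y 1 0 - u 1 0 * y 0 0) / D) *: w.
  apply/matrixP => i j; rewrite ord1 !mxE; move: D0; rewrite /D => D0'.
  by case: (I2_cases i) => ->; field.
exact: h2.
Qed.

(* The coordinate along [u] in the frame [(b, u, w)]; it vanishes on the line
   through [b] directed by [w]. *)
Definition framecrd : MP :=
  mpolyC 2 ((o 0 0 - b 0 0) * w 1 0 / D - (o 1 0 - b 1 0) * w 0 0 / D)
  + mpolyC 2 (w 1 0 / D) * 'x_0 - mpolyC 2 (w 0 0 / D) * 'x_1.

Lemma ev_framecrd x :
  ev framecrd x = ((x 0 0 - b 0 0) * w 1 0 - (x 1 0 - b 1 0) * w 0 0) / D.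
Proof. by rewrite /framecrd evB evD !evM !evC !evX; field. Qed.

(** In the coordinates of the frame the line is the zero set of the first variable. The monomials
    free of that variable, gathered in [r'], are the value of the polynomial on the line; this
    vanishes on ]0, 1[, hence identically, and what remains is divisible. *)
Lemma framecrd_dvd m p : (msize p <= m.+1)%N ->
  (forall s, 0 < s < 1 -> ev p (b + s *: w) = 0) ->
  exists2 q, (msize q <= m)%N & p = framecrd * q.
Proof.
move=> sp h.
pose k (x : E) : 'I_2 -> R := fun i => if i == 0 then
  ((x 0 0 - b 0 0) * w 1 0 - (x 1 0 - b 1 0) * w 0 0) / D else
  (u 0 0 * (x 1 0 - b 1 0) - u 1 0 * (x 0 0 - b 0 0)) / D.
have [|p' sp' pE] := @meval_affine E k (fun x i => x i 0 - o i 0)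
    (fun i j => if j == 0 then u i 0 else w i 0) (fun i => b i 0 - o i 0) _ p.
  move=> x i; rewrite /k /=; move: D0; rewrite /D => D0'.
  by case: (I2_cases i) => ->; field.
pose q' := \sum_(c <- msupp p' | c 0 != 0%N) mcoeff c p' *: mpolyX R (mnm_sub c (mnm1 0)).
pose r' := \sum_(c <- msupp p' | c 0 == 0%N) mcoeff c p' *: mpolyX R c.
have p'E : p' = 'x_0 * q' + r'.
  rewrite {1}(mpolyE p') (bigID (fun c : multinom 2 => c 0 != 0%N)) /=; congr (_ + _).
    rewrite mulr_sumr; apply: eq_bigr => c c0; rewrite -scalerAr -mpolyXD.
    congr (_ *: mpolyX R _); apply/mnmP => j; rewrite mnmDE mnmBE mnm1E.
    by case: eqVneq => [<-|_] //; rewrite subnKC // lt0n.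
  by apply: eq_bigl => c; rewrite negbK.
have r'0 g : meval g r' = 0.
  have e1 : meval g r' = meval (fun i => if i == 0 then 0 else g 1) p'.
    rewrite {1}p'E mevalD mevalMr mevalXU /= mul0r add0r /r' !raddf_sum /=.
    apply: eq_bigr => c /eqP c0; rewrite !mevalZ !mevalX; congr (_ * _).
    rewrite !big_ord_recl !big_ord0 /= !mulr1.
    have -> : lift ord0 ord0 = 1 :> 'I_2 by apply/val_inj.
    by rewrite (_ : ord0 = 0) ?c0 ?expr0 //; apply/val_inj.
  have Ev0 (y : R) : meval (fun i : 'I_2 => if i == 0 then 0 else y) p' = ev p (b + y *: w).
    rewrite /ev pE; apply: meval_eq => i; rewrite /k !mxE; move: D0; rewrite /D => D0'.
    by case: (I2_cases i) => -> /=; field.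
  have P0 : restr b w p = 0 by apply: poly_eq0_oo => s s01; rewrite horner_restr h.
  by rewrite e1 Ev0 -horner_restr P0 horner0.
have sq' : (msize q' <= m)%N.
  rewrite /q' big_seq_cond; apply: (big_ind (fun q => msize q <= m)%N); first by rewrite msize0.
    by move=> ? ?; apply: msizeD_leq.
  move=> c /andP[cp c0]; apply: msizeZ_leq; rewrite msizeX.
  have /msize_mdeg_lt /leq_trans := cp => /(_ _ (leq_trans sp' sp)); rewrite ltnS.
  apply: leq_trans; rewrite !mdegE !sum_I2 !mnmBE !mnm1E /=.
  by move: c0; case: (c 0) => // n _; rewrite subn1 subn0.
have [|q sq qE] := @meval_affine E (fun x i => x i 0 - o i 0) k
   (fun i j => if i == 0 then (if j == 0 then w 1 0 / D else - w 0 0 / D)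
               else (if j == 0 then - u 1 0 / D else u 0 0 / D))
   (fun i => if i == 0 then ((o 0 0 - b 0 0) * w 1 0 - (o 1 0 - b 1 0) * w 0 0) / D
     else (u 0 0 * (o 1 0 - b 1 0) - u 1 0 * (o 0 0 - b 0 0)) / D) _ q'.
  move=> x i; rewrite /k /=; move: D0; rewrite /D => D0'.
  by case: (I2_cases i) => -> /=; field.
exists q; first exact: leq_trans sq sq'.
apply: ev_inj => x; rewrite evM ev_framecrd {1}/ev pE {1}p'E mevalD r'0 addr0.
by rewrite mevalMr mevalXU qE.
Qed.

End Frame.
End Ev.

(** * The Euler operator *)

Definition euler p : MP := locked ('x_0 * mderiv 0 p + 'x_1 * mderiv 1 p).

Lemma eulerE p : euler p = 'x_0 * mderiv 0 p + 'x_1 * mderiv 1 p.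
Proof. by rewrite /euler -lock. Qed.

Lemma eulerD p q : euler (p + q) = euler p + euler q.
Proof. by rewrite !eulerE !mderivD !mulrDr addrACA. Qed.

Lemma eulerZ c p : euler (c *: p) = c *: euler p.
Proof. by rewrite !eulerE !mderivZ -!scalerAr scalerDr. Qed.

Lemma euler0 : euler 0 = 0.
Proof. by rewrite -(scale0r 0) eulerZ !scale0r. Qed.

Lemma eulerX m : euler (mpolyX R m) = (mdeg m)%:R *: mpolyX R m.
Proof.
have h i : 'x_i * mderiv i (mpolyX R m) = (m i)%:R *: mpolyX R m.
  rewrite mderivX -scalerAr; have [->|mi] := eqVneq (m i) 0%N; first by rewrite !scale0r.
  rewrite -mpolyXD; congr (_ *: mpolyX R _); apply/mnmP => j; rewrite mnmDE mnmBE mnm1E.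
  by case: eqVneq => [<-|_] //; rewrite subnKC // lt0n.
by rewrite eulerE !h -scalerDl -natrD mdegE sum_I2.
Qed.

Lemma mcoeff_euler c p : mcoeff c (euler p) = (mdeg c)%:R * mcoeff c p.
Proof.
rewrite [in LHS](mpolyE p) (big_morph _ eulerD euler0) raddf_sum [in RHS](mpolyE p).
rewrite [X in _ = _ * X]raddf_sum mulr_sumr /=; apply: eq_bigr => m _; rewrite eulerZ eulerX !mcoeffZ mcoeffX.
by case: eqVneq => [->|_]; rewrite ?mulr0 //= !mulr1 mulrC.
Qed.

Lemma msize_euler p n : (msize p <= n)%N -> (msize (euler p) <= n)%N.
Proof.
by move/msize_coefP => h; apply/msize_coefP => c /h; rewrite mcoeff_euler => ->; rewrite mulr0.
Qed.

(** On the monomials of degree d the operator is multiplication by d + n + 1, which is not zero. *)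
Lemma euler_addn_eq0 n p : euler p + n.+1%:R *: p = 0 -> p = 0.
Proof.
move=> h; apply/mpolyP => c; rewrite mcoeff0; move/mpolyP/(_ c): h.
rewrite mcoeffD mcoeffZ mcoeff_euler mcoeff0 -mulrDl -natrD => /eqP.
by rewrite mulf_eq0 pnatr_eq0 addnS => /orP[//|/eqP].
Qed.

(* Homogeneous components of degree [d] are eigenvectors of [euler] for [d]. *)
Lemma euler_addn_surj n p :
  exists2 q, (msize q <= msize p)%N & euler q + n.+1%:R *: q = p.
Proof.
exists (\sum_(m <- msupp p) (mcoeff m p / (mdeg m + n.+1)%:R) *: mpolyX R m).
  rewrite big_seq; apply: (big_ind (fun q => msize q <= msize p)%N); first by rewrite msize0.
    by move=> ? ?; apply: msizeD_leq.
  by move=> m mp; apply: msizeZ_leq; rewrite msizeX msize_mdeg_lt.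
rewrite (big_morph _ eulerD euler0) scaler_sumr -big_split /= [RHS]mpolyE.
apply: eq_bigr => m _; rewrite eulerZ eulerX !scalerA -scalerDl; congr (_ *: _).
by rewrite [_ / _ * _]mulrC -mulrDl -natrD mulrC divfK // pnatr_eq0 addnS.
Qed.

End Poly2.

(** * Affine substitution in Lebesgue integrals *)

Section AffineSubstitution.
Variable R : realType.
Local Notation mu := (@lebesgue_measure R).

Lemma measurable_affine (c e : R) :
  measurable_fun [set: measurableTypeR R] (fun x : measurableTypeR R => c * x + e : measurableTypeR R).
Proof.
by apply: measurable_funD => //; apply: measurable_funM.
Qed.

(** By uniqueness of Lebesgue measure it is enough to compare half-open intervals. Their preimages
    are intervals; a negative slope exchanges the ends, and with them the open and the closed
    one. *)
Lemma lebesgue_measure_affine (c e : R) (X : set (measurableTypeR R)) : c != 0 -> measurable X ->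
  mu X = (`|c|%:E * pushforward mu (fun x : measurableTypeR R => c * x + e : measurableTypeR R)%R X)%E.
Proof.
move=> c0 mX; have mphi := measurable_affine c e.
apply: (@lebesgue_measure_unique R
  (mscale (NngNum (normr_ge0 c)) (pushforward mu _))) => //.
move=> {mX}X [[a b]] _ <- /=.
rewrite /mscale /= /pushforward.
have [c1|c1] := ltP 0 c.
  have -> : (fun x => c * x + e) @^-1` [set` `]a, b]] = [set` `](a - e) / c, (b - e) / c]].
    apply/seteqP; split => x /=; rewrite !in_itv /= ltr_pdivrMr // ler_pdivlMr // ltrBlDr lerBrDr mulrC //.
  rewrite !lebesgue_measure_itv /= !lte_fin ltr_pM2r ?invr_gt0 // ltrD2r.
  case: ifP => _; last by rewrite mule0.
  by rewrite -!EFinB -EFinM gtr0_norm //; congr EFin; field.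
have {c1} c1 : c < 0 by rewrite lt_neqAle c0.
have -> : (fun x => c * x + e) @^-1` [set` `]a, b]] = [set` `[(b - e) / c, (a - e) / c[].
  apply/seteqP; split => x /=; rewrite !in_itv /= ler_ndivrMr // ltr_ndivlMr // ltrBlDr lerBrDr mulrC andbC //.
rewrite !lebesgue_measure_itv /= !lte_fin ltr_nM2r ?invr_lt0 // ltrD2r.
case: ifP => _; last by rewrite mule0.
by rewrite -!EFinB -EFinM ltr0_norm //; congr EFin; field.
Qed.

Lemma ge0_integral_affine (c e : R) (f : measurableTypeR R -> \bar R) : c != 0 ->
  measurable_fun setT f -> (forall x, 0 <= f x)%E ->
  (\int[mu]_x f x = `|c|%:E * \int[mu]_x f (c * x + e)%R)%E.
Proof.
move=> c0 mf f0; have mphi := measurable_affine c e.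
rewrite -[X in (_ * X)%E](@ge0_integral_pushforward _ _ _ _ _ _ mphi mu setT) //.
rewrite -(ge0_integral_mscale _ _ (NngNum (normr_ge0 c))) //.
by apply: eq_measure_integral => A mA _ /=; exact: lebesgue_measure_affine.
Qed.

Local Notation mu2 := (mu \x mu)%E.
Local Notation T2 := (measurableTypeR R * measurableTypeR R)%type.

Lemma measurable_affine2 (c d e : R) :
  measurable_fun [set: T2] (fun z : T2 => e + z.1 * c + z.2 * d : measurableTypeR R).
Proof.
apply: measurable_funD; last by apply: measurable_funM => //; exact: measurable_snd.
by apply: measurable_funD => //; apply: measurable_funM => //; exact: measurable_fst.
Qed.

Lemma measurable_affine_map (b0 b1 u0 u1 w0 w1 : R) :
  measurable_fun [set: T2]
    (fun z : T2 => (b0 + z.1 * u0 + z.2 * w0, b1 + z.1 * u1 + z.2 * w1) : T2).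
Proof. by apply/measurable_fun_pair; exact: measurable_affine2. Qed.

(** Elimination with pivot [u0]: the affine map is composed of one substitution in each coordinate,
    of slopes [u0] and [D / u0], and Tonelli's theorem allows each to be made in the inner
    integral. *)
Let ge0_integral_affine2_aux (b0 b1 u0 u1 w0 w1 : R) (f : T2 -> \bar R) :
  u0 != 0 -> u0 * w1 - u1 * w0 != 0 ->
  measurable_fun setT f -> (forall z, 0 <= f z)%E ->
  (\int[mu2]_z f z = `|u0 * w1 - u1 * w0|%:E *
    \int[mu2]_z f (b0 + z.1 * u0 + z.2 * w0, b1 + z.1 * u1 + z.2 * w1)%R)%E.
Proof.
move=> u00 D0 mf f0.
set D := u0 * w1 - u1 * w0.
have mfA := measurableT_comp mf (measurable_affine_map b0 b1 u0 u1 w0 w1).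
rewrite (fubini_tonelli2 (f \o _) mfA) //= /fubini_G.
(* [g] changes the second coordinate only; the shift [e] is chosen so that the substitution
   [x * u0 + (b0 + y * w0)] in the first coordinate then restores the full map. *)
pose e X := b1 + u1 * (X - b0) / u0.
pose g (z : T2) := f (z.1, D / u0 * z.2 + e z.1).
have mg : measurable_fun setT g.
  apply: measurableT_comp => //; apply/measurable_fun_pair => /=; first exact: measurable_fst.
  rewrite /e; apply: measurable_funD.
    by apply: measurable_funM => //; exact: measurable_snd.
  apply: measurable_funD => //; apply: measurable_funM => //; apply: measurable_funM => //.
  by apply: measurable_funB => //; exact: measurable_fst.
have inner y : (\int[mu]_x g (x, y) = `|u0|%:E *
    \int[mu]_x f (b0 + x * u0 + y * w0, b1 + x * u1 + y * w1)%R)%E.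
  rewrite (@ge0_integral_affine u0 (b0 + y * w0)) //; last 2 first.
  - exact: (measurableT_comp mg (pair2_measurable y)).
  - by move=> x; exact: f0.
  congr (_ * _)%E; apply: eq_integral => x _; rewrite /g /e /=.
  by congr (f (_, _)); rewrite ?/D; field.
have -> : (`|D|%:E = `|D / u0|%:E * `|u0|%:E)%E.
  by rewrite -EFinM -normrM divfK.
rewrite -muleA -ge0_integralZl //; last 2 first.
- by apply: (measurable_fun_fubini_tonelli_G (f \o _) mfA) => z; exact: f0.
- by move=> y _; apply: integral_ge0 => x _; exact: f0.
under [X in (_ * X)%E]eq_integral do rewrite -inner.
rewrite -(fubini_tonelli g mg (fun z => f0 _)) -ge0_integralZl //; last 2 first.
- by apply: (measurable_fun_fubini_tonelli_F g mg) => z; exact: f0.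
- by move=> y _; apply: integral_ge0 => x _; exact: f0.
rewrite (fubini_tonelli1 f) //; apply: eq_integral => x _; rewrite /fubini_F.
rewrite (@ge0_integral_affine (D / u0) (e x)) //.
  by rewrite mulf_neq0 // invr_neq0.
exact: (measurableT_comp mf (pair1_measurable x)).
Qed.

Lemma ge0_integral_affine2 (b0 b1 u0 u1 w0 w1 : R) (f : T2 -> \bar R) :
  u0 * w1 - u1 * w0 != 0 ->
  measurable_fun setT f -> (forall z, 0 <= f z)%E ->
  (\int[mu2]_z f z = `|u0 * w1 - u1 * w0|%:E *
    \int[mu2]_z f (b0 + z.1 * u0 + z.2 * w0, b1 + z.1 * u1 + z.2 * w1)%R)%E.
Proof.
move=> D0 mf f0; have [u00|u00] := eqVneq u0 0; last exact: ge0_integral_affine2_aux.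
(* If [u0 = 0] then [u1] is not zero; exchanging the coordinates makes it the pivot and changes only
   the sign of the determinant. *)
have mswap : measurable_fun [set: T2] (fun z : T2 => (z.2, z.1) : T2).
  by apply/measurable_fun_pair; [exact: measurable_snd|exact: measurable_fst].
have swapE (g : T2 -> \bar R) : measurable_fun setT g -> (forall z, 0 <= g z)%E ->
    (\int[mu2]_z g z = \int[mu2]_z g (z.2, z.1))%E.
  move=> mg g0; rewrite (fubini_tonelli1 g) //.
  by rewrite (fubini_tonelli2 (fun z => g (z.2, z.1))) //; apply: (measurableT_comp mg mswap).
have DE : u1 * w0 - u0 * w1 = - (u0 * w1 - u1 * w0) by ring.
rewrite (swapE f) // (@ge0_integral_affine2_aux b1 b0 u1 u0 w1 w0) //.
- by rewrite DE normrN.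
- by apply: contraNneq D0 => ->; rewrite u00 !mul0r subrr.
- by rewrite DE oppr_eq0.
- exact: (measurableT_comp mf mswap).
Qed.

Lemma integral_affine2 (b0 b1 u0 u1 w0 w1 : R) (f : T2 -> \bar R) :
  u0 * w1 - u1 * w0 != 0 -> measurable_fun setT f ->
  (\int[mu2]_z f z = `|u0 * w1 - u1 * w0|%:E *
    \int[mu2]_z f (b0 + z.1 * u0 + z.2 * w0, b1 + z.1 * u1 + z.2 * w1)%R)%E.
Proof.
move=> D0 mf; rewrite [in LHS]integralE [in RHS]integralE.
rewrite (@ge0_integral_affine2 b0 b1 u0 u1 w0 w1 (f^\+)%E) //; last exact: measurable_funepos.
rewrite (@ge0_integral_affine2 b0 b1 u0 u1 w0 w1 (f^\-)%E) //; last exact: measurable_funeneg.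
set a := (\int[_]_z _)%E; set c := (X in (_ - _ * X)%E).
have a0 : (0 <= a)%E by apply: integral_ge0 => z _.
have c0 : (0 <= c)%E by apply: integral_ge0 => z _.
have D1 : (0 < `|u0 * w1 - u1 * w0|%:E)%E by rewrite lte_fin normr_gt0.
transitivity (`|u0 * w1 - u1 * w0|%:E * (a - c))%E; last first.
  by congr (_ * (_ - _))%E; apply: eq_integral => z _; rewrite ?funeposE ?funenegE.
(* Integrability is not assumed, so the integrals of the two parts may be infinite and
   distributivity is checked case by case. *)
case: a a0 => [a| |] // _; case: c c0 => [c| |] // _.
- by rewrite muleBr.
- by rewrite /= gt0_muley // -EFinM /= gt0_muleNy.
- by rewrite /= gt0_muley.
- by rewrite /= gt0_muley //= gt0_muleNy.
Qed.

End AffineSubstitution.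

(** * Integrals of polynomials *)

Section PolynomialIntegrals.
Variable R : realType.
Local Notation mu := (@lebesgue_measure R).

Lemma derivable_horner (p : {poly R}) x : derivable (horner p) x 1.
Proof. by have h := is_derive_poly p x; exact: ex_derive. Qed.

Lemma cvg_horner (p : {poly R}) x : horner p @ x --> p.[x].
Proof. by apply: differentiable_continuous; apply/derivable1_diffP/derivable_horner. Qed.

Lemma integrable_horner (a b : R) (p : {poly R}) :
  mu.-integrable `[a, b] (EFin \o horner p).
Proof.
apply: continuous_compact_integrable; first exact: segment_compact.
by apply: continuous_subspaceT => x; exact: cvg_horner.
Qed.

Lemma integral_deriv_poly (a b : R) (p : {poly R}) : a <= b ->
  (\int[mu]_(s in `[a, b]) (p^`().[s])%:E = (p.[b] - p.[a])%:E)%E.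
Proof.
rewrite le_eqVlt => /predU1P[<-|ab]; first by rewrite set_itv1 integral_set1 subrr.
rewrite (@continuous_FTC2 R (horner p^`()) (horner p)) //.
- by apply: continuous_subspaceT => x; exact: cvg_horner.
- split; first by move=> x _; exact: derivable_horner.
    by apply: cvg_at_right_filter; exact: cvg_horner.
  by apply: cvg_at_left_filter; exact: cvg_horner.
- by move=> x _; rewrite derive1E; have h := is_derive_poly p x; rewrite derive_val.
Qed.

Definition int01 (p : {poly R}) : R := \int[mu]_(s in `[0, 1]) p.[s].

Lemma int01D p q : int01 (p + q) = int01 p + int01 q.
Proof.
rewrite /int01 -RintegralD //; [|exact: integrable_horner..].
by apply: eq_Rintegral => s _; rewrite hornerD.
Qed.

Lemma int01Z c p : int01 (c *: p) = c * int01 p.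
Proof.
rewrite /int01 -RintegralZl //; last exact: integrable_horner.
by apply: eq_Rintegral => s _; rewrite hornerZ.
Qed.

Lemma int01B p q : int01 (p - q) = int01 p - int01 q.
Proof. by rewrite int01D -[- q]scaleN1r int01Z mulN1r. Qed.

Lemma int01_deriv p : int01 p^`() = p.[1] - p.[0].
Proof. by rewrite /int01 /Rintegral integral_deriv_poly. Qed.

Lemma int01_rev (p q : {poly R}) : (forall s, p.[s] = q.[1 - s]) -> int01 p = int01 q.
Proof.
move=> pq; rewrite /int01 [RHS]Rintegration_by_substitution_onem ?lexx ?ler01 //; last first.
  by apply: continuous_subspaceT => x; exact: cvg_horner.
by rewrite /unstable.onem subrr; apply: eq_Rintegral => s _; rewrite pq.
Qed.

(** The integral is at least [e] times the measure of [B]; integrability keeps it finite, so that it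
    stays positive under [fine]. *)
Lemma Rintegral_gt0 d (T : measurableType d) (m : {measure set T -> \bar R})
    (D B : set T) (f : T -> R) (e : R) :
  measurable D -> m.-integrable D (EFin \o f) -> (forall x, D x -> 0 <= f x) ->
  measurable B -> B `<=` D -> (0 < m B)%E -> 0 < e -> (forall x, B x -> e <= f x) ->
  0 < \int[m]_(x in D) f x.
Proof.
move=> mD fi f0 mB BD B0 e0 ef.
have mf : measurable_fun D (EFin \o f) by case/integrableP: fi.
have : (0 < \int[m]_(x in D) (f x)%:E)%E.
  apply: (@lt_le_trans _ _ (\int[m]_(x in B) (f x)%:E)%E).
    apply: (@lt_le_trans _ _ (\int[m]_(x in B) e%:E)%E).
      by rewrite integral_cst // mule_gt0.
    apply: ge0_le_integral => //; last exact: measurable_funS mf.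
    by move=> x _; exact: (@ltW _ _ 0%:E e%:E).
  by apply: ge0_subset_integral => // x Dx; rewrite lee_fin f0.
by rewrite /Rintegral => h; apply: fine_gt0; rewrite h /= ltey_eq (integrable_fin_num mD fi).
Qed.

Lemma int01_eq0 (p : {poly R}) :
  (forall s : R, 0 <= s <= 1 -> 0 <= p.[s]) -> int01 p = 0 -> p = 0.
Proof.
move=> p0 h; apply: poly_eq0_oo => s0 s01; apply/eqP; apply: contraT => ps0.
have {}ps0 : 0 < p.[s0].
  by rewrite lt_neqAle eq_sym ps0 p0 //; move/andP: s01 => [a b]; rewrite !ltW.
suff : 0 < int01 p by rewrite h ltxx.
have /nbhs_ballP[e /= e0 he] : \forall s \near s0, p.[s0] / 2 < p.[s] /\ 0 < s < 1.
  near=> s; split; last first.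
    have : s \in `]0, 1[ by near: s; apply: near_in_itvoo; rewrite in_itv.
    by rewrite in_itv.
  near: s; apply: (cvgr_gt p.[s0]); first exact: cvg_horner.
  by rewrite ltr_pdivrMr // ltr_pMr // ltr1n.
have {}he (x : R) : x \in `]s0 - e, s0 + e[ -> p.[s0] / 2 < p.[x] /\ 0 < x < 1.
  rewrite in_itv /= => /andP[a b]; apply: he; rewrite /ball /= ltr_norml.
  by apply/andP; split; lra.
apply: (@Rintegral_gt0 _ _ mu _ `]s0 - e, s0 + e[%classic _ (p.[s0] / 2)) => //.
- exact: integrable_horner.
- by move=> x /he [_ /andP[a b]]; rewrite /= in_itv /= !ltW.
- rewrite /= lebesgue_measure_itv /= lte_fin ltrBlDr -addrA ltrDl addr_gt0 //.
  by rewrite -EFinB lte_fin; lra.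
- by rewrite divr_gt0.
- by move=> x /he [/ltW].
Unshelve. all: by end_near. Qed.

Section Plane.
Local Notation mu2 := (mu \x mu)%E.
Local Notation T2 := (measurableTypeR R * measurableTypeR R)%type.

Definition ref_triangle : set T2 := [set z | [/\ 0 <= z.1, 0 <= z.2 & z.1 + z.2 <= 1]].

Lemma measurable_ref_triangle : measurable ref_triangle.
Proof.
have -> : ref_triangle = (fst @^-1` `[0, +oo[) `&` (snd @^-1` `[0, +oo[) `&`
    ((fun z : T2 => z.1 + z.2 : measurableTypeR R) @^-1` `]-oo, 1]).
  apply/seteqP; split => z /=; rewrite !in_itv /= ?andbT; first by case.
  by case=> -[].
have h (f : T2 -> measurableTypeR R) (i : interval R) :
    measurable_fun setT f -> measurable (f @^-1` [set` i]).
  by move=> mf; rewrite -[X in measurable X]setTI; apply: mf.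
apply: measurableI; first by apply: measurableI; apply: h.
by apply: h; apply: measurable_funD.
Qed.

Lemma measurable_ev (o : 'cV[R]_2) (g : T2 -> 'cV[R]_2) p :
  (forall i, measurable_fun setT (fun z => g z i 0)) ->
  measurable_fun setT (fun z => ev o p (g z)).
Proof.
move=> mg.
elim/mpoly_gen_ind: p => [c|i|p q hp hq|p q hp hq].
- by rewrite (_ : (fun z => _) = cst c) //; apply/funext => z; rewrite evC.
- rewrite (_ : (fun z => _) = (fun z => g z i 0) \- cst (o i 0)); last by apply/funext => z; rewrite evX.
  exact: measurable_funB.
- rewrite (_ : (fun z => _) = (fun z => ev o p (g z)) \+ (fun z => ev o q (g z))); last by apply/funext => z; rewrite evD.
  exact: measurable_funD.
- rewrite (_ : (fun z => _) = (fun z => ev o p (g z)) \* (fun z => ev o q (g z))); last by apply/funext => z; rewrite evM.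
  exact: measurable_funM.
Qed.

Section Bounded.
Variables (M : R) (D : set T2).
Hypothesis mD : measurable D.
Hypothesis DM : forall z, D z -> `|z.1| <= M /\ `|z.2| <= M.

Lemma bounded_measure_lty : (mu2 D < +oo)%E.
Proof.
have sD : D `<=` `[- M, M]%classic `*` `[- M, M]%classic.
  by move=> z /DM[]; rewrite !ler_norml /= !in_itv.
apply: (@le_lt_trans _ _ (mu2 (`[- M, M]%classic `*` `[- M, M]%classic))).
  by apply: le_measure; rewrite ?inE //; apply: measurableX.
have muM : (mu [set` `[- M, M]%R]%classic < +oo)%E.
  by rewrite lebesgue_measure_itv /=; case: ifP => _; rewrite ?ltry // -EFinB ltry.
by rewrite product_measure1E //= lte_mul_pinfty // ge0_fin_numE.
Qed.

Lemma integrable_ev (o : 'cV[R]_2) (g : T2 -> 'cV[R]_2) p :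
  (forall i, measurable_fun setT (fun z => g z i 0)) ->
  (exists N, forall z i, D z -> `|g z i 0| <= N) ->
  mu2.-integrable D (EFin \o (fun z => ev o p (g z))).
Proof.
move=> mg [N gN].
apply: measurable_bounded_integrable => //; first exact: bounded_measure_lty.
  by apply: measurable_funTS; exact: measurable_ev.
have [C hC] : exists C, forall z, D z -> `|ev o p (g z)| <= C.
  elim/mpoly_gen_ind: p => [c|i|p q [C hp] [C' hq]|p q [C hp] [C' hq]].
  - by exists `|c| => z _; rewrite evC.
  - exists (N + `|o i 0|) => z Dz; rewrite evX (le_trans (ler_normB _ _)) // lerD2r gN //.
  - exists (C + C') => z Dz; rewrite evD (le_trans (ler_normD _ _)) // lerD ?hp ?hq //.
  - exists (C * C') => z Dz; rewrite evM normrM ler_pM ?hp ?hq //.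
by exists C; split=> [|x Cx z Dz /=]; rewrite ?num_real // (le_trans (hC _ Dz)) // ltW.
Qed.

End Bounded.

Lemma ref_triangle_le1 z : ref_triangle z -> `|z.1| <= 1 /\ `|z.2| <= 1.
Proof. by case=> z1 z2 z12; rewrite !ger0_norm //; split; lra. Qed.

Lemma measurable_frame (b u w : 'cV[R]_2) i :
  measurable_fun setT (fun z : T2 => (b + z.1 *: u + z.2 *: w) i 0 : measurableTypeR R).
Proof.
rewrite (_ : (fun z => _) = (fun z => b i 0 + z.1 * u i 0 + z.2 * w i 0)).
  exact: measurable_affine2.
by apply/funext => z; rewrite !mxE.
Qed.

Lemma integrable_ref_triangle o (b u w : 'cV[R]_2) p :
  mu2.-integrable ref_triangle (EFin \o (fun z => ev o p (b + z.1 *: u + z.2 *: w))).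
Proof.
apply: (@integrable_ev 1 _ measurable_ref_triangle ref_triangle_le1 o
  (fun z => b + z.1 *: u + z.2 *: w)).
  exact: measurable_frame.
exists (\sum_i (`|b i 0| + `|u i 0| + `|w i 0|)) => z i /ref_triangle_le1[z1 z2].
rewrite sum_I2 !mxE.
have h j : `|b j 0 + z.1 * u j 0 + z.2 * w j 0| <= `|b j 0| + `|u j 0| + `|w j 0|.
  rewrite (le_trans (ler_normD _ _)) // lerD //.
    by rewrite (le_trans (ler_normD _ _)) // lerD2l normrM ler_piMl.
  by rewrite normrM ler_piMl.
have h0 j : 0 <= `|b j 0| + `|u j 0| + `|w j 0| by rewrite !addr_ge0.
by case: (I2_cases i) => ->; rewrite (le_trans (h _)) // ?lerDl ?lerDr.
Qed.

(** Fubini with the inner integral along [u]: at height y the section is [0, 1 - y], and the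
    fundamental theorem leaves the values on the side from [b + u] to [b + w] minus those on the
    side from [b] to [b + w]. *)
Lemma Rintegral_ref_deriv o (b u w : 'cV[R]_2) p :
  \int[mu2]_(z in ref_triangle) ev o (mdirderiv u p) (b + z.1 *: u + z.2 *: w) =
  int01 (restr o (b + u) (w - u) p - restr o b w p).
Proof.
rewrite /int01 /Rintegral; congr fine.
have fi := integrable_ref_triangle o b u w (mdirderiv u p).
rewrite [LHS]integral_mkcond -integral21_prod_meas1; last first.
  exact/(integrable_mkcond _ measurable_ref_triangle).
rewrite [RHS]integral_mkcond; apply: eq_integral => y _; rewrite /fubini_G.
have [y01|y01] := boolP (0 <= y <= 1).
  have yI : y \in `[0, 1]%classic by rewrite inE /= in_itv.
  rewrite [in RHS]/patch yI.
  pose c : R := 1 - y.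
  transitivity (\int[mu]_(x in `[0%R, c]) ((restr o (b + y *: w) u p)^`().[x])%:E)%E.
    rewrite [RHS]integral_mkcond; apply: eq_integral => x _.
    rewrite /patch /= deriv_restr horner_restr addrAC.
    have -> : ((x, y) \in ref_triangle) = (x \in `[0, c]%classic).
      move/andP: y01 => [y0 y1]; apply/idP/idP; rewrite !inE /= in_itv /= /c.
        by case => /= x0 _ xy; rewrite x0 lerBrDr.
      by move=> /andP[x0 xy]; split; rewrite //= -lerBrDr.
    by [].
  rewrite /c integral_deriv_poly ?subr_ge0 //; last by case/andP: y01.
  rewrite !horner_restr hornerD hornerN !horner_restr scale0r addr0.
  rewrite (_ : b + y *: w + (1 - y) *: u = b + u + y *: (w - u)) //.
  by apply/matrixP => i j; rewrite !mxE; ring.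
have yI : (y \in `[0, 1]%classic) = false.
  by apply/negbTE; apply: contra y01; rewrite inE /= in_itv.
rewrite [in RHS]/patch yI.
apply: integral0_eq => x _; rewrite /patch ifF //; apply/negbTE; apply: contra y01.
by rewrite inE => -[/= x0 y0 xy]; rewrite y0; lra.
Qed.
End Plane.
End PolynomialIntegrals.
Arguments ref_triangle {R}.
Arguments measurable_ref_triangle {R}.

(** * The divergence theorem on a triangle *)

Section TriangleIntegral.
Variable R : realType.
Local Notation mu := (@lebesgue_measure R).
Local Notation mu2 := (mu \x mu)%E.
Local Notation T2 := (measurableTypeR R * measurableTypeR R)%type.
Local Notation E := 'cV[R]_2.
Local Notation MP := (mpoly 2 R).

Definition frame_triangle (b u w : E) : set T2 :=
  [set z | exists2 y, ref_triangle y & point_of z = b + y.1 *: u + y.2 *: w].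

Section Frame.
Variables (b u w : E).
Let D : R := u 0 0 * w 1 0 - u 1 0 * w 0 0.
Hypothesis D0 : D != 0.

(** Cramer's rule inverts the frame; the triangle is thus an affine preimage of the reference
    triangle, hence measurable. *)
Lemma frame_triangleE z : frame_triangle b u w z <->
  ref_triangle ((b 1 0 * w 0 0 - b 0 0 * w 1 0) / D + z.1 * (w 1 0 / D) + z.2 * (- w 0 0 / D),
                (b 0 0 * u 1 0 - b 1 0 * u 0 0) / D + z.1 * (- u 1 0 / D) + z.2 * (u 0 0 / D)).
Proof.
move: D0; rewrite /D => D0'; split=> [[y hy zE]|h].
  have z1 : z.1 = b 0 0 + y.1 * u 0 0 + y.2 * w 0 0.
    by have := congr1 (fun m : E => m 0 0) zE; rewrite !mxE /=.
  have z2 : z.2 = b 1 0 + y.1 * u 1 0 + y.2 * w 1 0.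
    by have := congr1 (fun m : E => m 1 0) zE; rewrite !mxE /=.
  have h c d : c = y.1 -> d = y.2 -> ref_triangle (c, d).
    by move=> -> ->; rewrite -surjective_pairing.
  by apply: h; rewrite z1 z2; field.
apply: (ex_intro2 _ _ _ h).
by apply/matrixP => i j; rewrite ord1 !mxE /=; case: (I2_cases i) => -> /=; field.
Qed.

Lemma measurable_frame_triangle : measurable (frame_triangle b u w).
Proof.
rewrite (_ : frame_triangle b u w = (fun z : T2 =>
  ((b 1 0 * w 0 0 - b 0 0 * w 1 0) / D + z.1 * (w 1 0 / D) + z.2 * (- w 0 0 / D),
   (b 0 0 * u 1 0 - b 1 0 * u 0 0) / D + z.1 * (- u 1 0 / D) + z.2 * (u 0 0 / D)) : T2)
  @^-1` ref_triangle); last by apply/seteqP; split => z; rewrite /= frame_triangleE.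
rewrite -[X in measurable X]setTI; apply: measurable_affine_map => //.
exact: measurable_ref_triangle.
Qed.

Lemma Rintegral_frame_triangle o (p : MP) :
  \int[mu2]_(z in frame_triangle b u w) ev o p (point_of z) =
  `|D| * \int[mu2]_(z in ref_triangle) ev o p (b + z.1 *: u + z.2 *: w).
Proof.
rewrite {1}/Rintegral integral_mkcond.
rewrite (@integral_affine2 R (b 0 0) (b 1 0) (u 0 0) (u 1 0) (w 0 0) (w 1 0)) //; last first.
  apply/(measurable_restrictT _ measurable_frame_triangle).
  apply/measurable_EFinP; apply: measurable_funTS; apply: (measurable_ev o p) => i.
  rewrite (_ : (fun z => _) = (fun z : T2 => if i == 0 then z.1 else z.2)).
    by case: (i == 0); [exact: measurable_fst|exact: measurable_snd].
  by apply/funext => z; rewrite mxE.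
have pE (z : T2) : point_of (b 0 0 + z.1 * u 0 0 + z.2 * w 0 0, b 1 0 + z.1 * u 1 0 + z.2 * w 1 0)
    = b + z.1 *: u + z.2 *: w.
  by apply/matrixP => i j; rewrite ord1 !mxE /=; case: (I2_cases i) => ->.
under eq_integral => z _.
  rewrite /patch /= pE.
  rewrite (_ : (_ \in frame_triangle b u w) = (z \in ref_triangle)); last first.
    apply/idP/idP; rewrite !inE; last by move=> hz; exists z => //; rewrite pE.
    rewrite frame_triangleE /=; move: D0; rewrite /D => D0'.
    have h c d : c = z.1 -> d = z.2 -> ref_triangle (c, d) -> ref_triangle z.
      by move=> -> ->; rewrite -surjective_pairing.
    by apply: h; field.
  over.
rewrite fineM //; last first.
  have := integrable_fin_num measurable_ref_triangle (integrable_ref_triangle o b u w p).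
  by rewrite integral_mkcond.
by rewrite /Rintegral [in RHS]integral_mkcond.
Qed.

End Frame.

Section Triangle.
Variables (a : 'I_3 -> E) (o : E).
Hypothesis nc : noncollinear a.
Let u := a 1 - a 0.
Let w := a 2 - a 0.
Let D : R := u 0 0 * w 1 0 - u 1 0 * w 0 0.

Lemma noncollinear_det : D != 0.
Proof.
move: nc; rewrite /noncollinear -/u -/w; set m := row_mx u w.
have mu0 i : m i 0 = u i 0.
  by rewrite -(row_mxEl u w i 0) /m; congr (_ i _); apply/val_inj.
have mw1 i : m i 1 = w i 0.
  by rewrite -(row_mxEr u w i 0) /m; congr (_ i _); apply/val_inj.
move: m mu0 mw1 => m mu0 mw1.
rewrite (expand_det_row _ 0) sum_I2 /cofactor !det_mx11 !mxE.
have -> : lift (0 : 'I_2) 0 = 1 by apply/val_inj.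
have -> : lift (1 : 'I_(1 + 1)) 0 = 0 by apply/val_inj.
rewrite !mu0 !mw1 /D /= expr0 expr1 mul1r mulN1r mulrN.
by rewrite [w 0 0 * _]mulrC.
Qed.

Lemma triangleP (x : E) : triangle a x <->
  exists y : T2, ref_triangle y /\ x = a 0 + y.1 *: u + y.2 *: w.
Proof.
split=> [[c [c0 c1 ->]]|[y [[y1 y2 y12] ->]]].
  exists (c 1, c 2); move: c1; rewrite !sum_I3 => c1; split.
    by split; rewrite /= ?c0 // -c1 -addrA lerDr.
  have -> : c 0 = 1 - c 1 - c 2 by rewrite -c1; ring.
  by apply/matrixP => i j; rewrite /u /w !mxE /=; ring.
exists (fun i => if i == 0 then 1 - y.1 - y.2 else if i == 1 then y.1 else y.2); split.
- by move=> i; case: (I3_cases i) => -> //=; lra.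
- by rewrite sum_I3 /=; ring.
- by rewrite sum_I3 /=; apply/matrixP => i j; rewrite /u /w !mxE; ring.
Qed.

Lemma triangle_frame : @point_of R @^-1` triangle a = frame_triangle (a 0) u w.
Proof.
apply/seteqP; split=> z /=; first by move/triangleP => [y [hy zE]]; exists y.
by case=> y hy zE; apply/triangleP; exists y.
Qed.

(** Exchanging the two legs gives the integral of a derivative along [w] from the formula for
    [u]. *)
Lemma triangle_frameC : @point_of R @^-1` triangle a = frame_triangle (a 0) w u.
Proof.
rewrite triangle_frame; apply/seteqP; split=> z [y [y1 y2 y12] zE];
  by exists (y.2, y.1); [split; rewrite //= addrC|rewrite zE /= addrAC].
Qed.

Definition tri_int (p : MP) : R :=
  \int[mu2]_(z in @point_of R @^-1` triangle a) ev o p (point_of z).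

Lemma tri_intE p : tri_int p =
  `|D| * \int[mu2]_(z in ref_triangle) ev o p (a 0 + z.1 *: u + z.2 *: w).
Proof. by rewrite /tri_int triangle_frame Rintegral_frame_triangle // noncollinear_det. Qed.

Lemma tri_intD p q : tri_int (p + q) = tri_int p + tri_int q.
Proof.
rewrite !tri_intE -mulrDr -RintegralD ?measurable_ref_triangle //.
- by congr (_ * _); apply: eq_Rintegral => z _; rewrite evD.
- exact: measurable_ref_triangle.
- exact: integrable_ref_triangle.
- exact: integrable_ref_triangle.
Qed.

Lemma tri_int_ge0_eq0 p : (forall x, triangle a x -> 0 <= ev o p x) -> tri_int p = 0 -> p = 0.
Proof.
move=> p0 pI; apply: (@ev_eq0_corner R o (a 0) u w noncollinear_det) => s0 r0 s0_gt0 r0_gt0 sr1.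
pose f (z : R * R) : R := ev o p (a 0 + z.1 *: u + z.2 *: w).
have f0 z : ref_triangle z -> 0 <= f z by move=> hz; apply/p0/triangleP; exists z.
apply/eqP; rewrite addrAC -/(f (s0, r0)); apply: contraT => fn0.
have z0 : ref_triangle (s0, r0) by split => /=; lra.
have {}fn0 : 0 < f (s0, r0) by rewrite lt_neqAle eq_sym fn0 f0.
suff : 0 < \int[mu2]_(z in ref_triangle) f z.
  move=> fpos; have := pI; rewrite tri_intE -/f => /eqP.
  by rewrite mulf_eq0 normr_eq0 (negbTE noncollinear_det) (gt_eqF fpos).
have cf : f @ ((s0 : R), (r0 : R)) --> f (s0, r0).
  rewrite /f; elim/mpoly_gen_ind: (p) => [c|i|q q' hq hq'|q q' hq hq'].
  - rewrite (_ : (fun z => _) = cst c); last by apply/funext => z; rewrite evC.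
    by rewrite evC; exact: cvg_cst.
  - rewrite (_ : (fun z => _) = (fun z : R * R => (a 0 i 0 + z.1 * u i 0 + z.2 * w i 0) - o i 0)).
      rewrite evX !mxE; apply: cvgB; last exact: cvg_cst.
      apply: cvgD; [apply: cvgD; first exact: cvg_cst|]; apply: cvgM; try exact: cvg_cst.
        exact: cvg_fst.
      exact: cvg_snd.
    by apply/funext => z; rewrite evX !mxE.
  - rewrite (_ : (fun z => _) = (fun z : R * R => ev o q (a 0 + z.1 *: u + z.2 *: w))
       \+ (fun z => ev o q' (a 0 + z.1 *: u + z.2 *: w))); last by apply/funext => z; rewrite evD.
    by rewrite evD; apply: cvgD.
  - rewrite (_ : (fun z => _) = (fun z : R * R => ev o q (a 0 + z.1 *: u + z.2 *: w))
       \* (fun z => ev o q' (a 0 + z.1 *: u + z.2 *: w))); last by apply/funext => z; rewrite evM.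
    by rewrite evM; apply: cvgM.
have : \forall z \near ((s0 : R), (r0 : R)), f (s0, r0) / 2 < f z.
  apply: (cvgr_gt _ cf).
  by rewrite ltr_pdivrMr // ltr_pMr // ltr1n.
move=> /nbhs_ballP[e /= e0 he].
(* Half-width of a square around the point on which [f] exceeds half its value there and which stays
   in the reference triangle; the last bound is halved because both coordinates may grow by [d]. *)
pose d := Num.min e (Num.min (Num.min s0 r0) ((1 - s0 - r0) / 2)).
have d0 : 0 < d by rewrite !lt_min e0 s0_gt0 r0_gt0 /=; lra.
have dle : [/\ d <= e, d <= s0, d <= r0 & d <= (1 - s0 - r0) / 2].
  by rewrite /d; split; rewrite !ge_min lexx ?orbT.
have [de ds dr dsr] := dle.
have muI (c : R) : (0 < mu [set` `]c - d, c + d[%R])%E.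
  rewrite lebesgue_measure_itv /= lte_fin ltrBlDr -addrA ltrDl addr_gt0 //.
  by rewrite -EFinB lte_fin; lra.
apply: (@Rintegral_gt0 R _ _ mu2 _ (`]s0 - d, s0 + d[%classic `*` `]r0 - d, r0 + d[%classic) _
   (f (s0, r0) / 2)) => //.
- exact: measurable_ref_triangle.
- exact: integrable_ref_triangle.
- exact: measurableX.
- move=> [x y] /= []; rewrite !in_itv /= => /andP[x1 x2] /andP[y1 y2].
  by split => /=; lra.
- by rewrite /= product_measure1E //; apply: mule_gt0; exact: muI.
- by rewrite divr_gt0.
- move=> [x y] /= []; rewrite !in_itv /= => /andP[x1 x2] /andP[y1 y2].
  apply/ltW/he; split; rewrite /ball /= ltr_norml; apply/andP; split; lra.
Qed.

Lemma tri_int_deriv_u p : tri_int (mdirderiv u p) =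
  `|D| * (int01 (restr o (a 1) (w - u) p) - int01 (restr o (a 0) w p)).
Proof.
rewrite tri_intE Rintegral_ref_deriv int01B.
by rewrite /u [a 0 + _]addrC subrK.
Qed.

Lemma tri_int_deriv_w p : tri_int (mdirderiv w p) =
  `|D| * (int01 (restr o (a 2) (u - w) p) - int01 (restr o (a 0) u p)).
Proof.
have DN : w 0 0 * u 1 0 - w 1 0 * u 0 0 = - D by rewrite /D; ring.
rewrite /tri_int triangle_frameC Rintegral_frame_triangle; last first.
  by rewrite DN oppr_eq0 noncollinear_det.
rewrite DN normrN Rintegral_ref_deriv int01B.
by rewrite /w [a 0 + _]addrC subrK.
Qed.

(* [(d 1 0, - d 0 0)] is a normal to the edge: the hypothesis says that the flux
   of [(p0, p1)] through each edge vanishes. *)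
Lemma tri_int_div_eq0 p0 p1 :
  (forall e, let d := edge_vec a e in int01 (restr o (a (ordS e)) d
     (mpolyC 2 (d 1 0) * p0 - mpolyC 2 (d 0 0) * p1)) = 0) ->
  tri_int (mderiv 0 p0 + mderiv 1 p1) = 0.
Proof.
move=> h; have D0 := noncollinear_det.
(* [al] and [be] are the components of the field (p0, p1) in the basis [u], [w]; its divergence is
   the sum of their derivatives along these vectors. *)
pose al := mpolyC 2 (w 1 0 / D) * p0 - mpolyC 2 (w 0 0 / D) * p1.
pose be := mpolyC 2 (u 0 0 / D) * p1 - mpolyC 2 (u 1 0 / D) * p0.
have -> : mderiv 0 p0 + mderiv 1 p1 = mdirderiv u al + mdirderiv w be.
  rewrite !mdirderivE /al /be !mderivB !mderiv_mulC; apply: (@ev_inj _ o) => x.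
  by rewrite !evE; rewrite /D in D0 *; field.
have rev x y p : int01 (restr o x (y - x) p) = int01 (restr o y (x - y) p).
  apply: int01_rev => s; rewrite !horner_restr; congr ev.
  by apply/matrixP => i j; rewrite !mxE; ring.
have h0 : int01 (restr o (a 1) (w - u) (al + be)) = 0.
  have := h 0; rewrite /edge_vec.
  have -> : ordS (0 : 'I_3) = 1 by apply/val_inj.
  have -> : ord_pred (0 : 'I_3) = 2 by apply/val_inj.
  have -> : a 2 - a 1 = w - u by rewrite /w /u opprB addrA subrK.
  move=> /= h0; have -> : al + be = D^-1 *:
     (mpolyC 2 ((w - u) 1 0) * p0 - mpolyC 2 ((w - u) 0 0) * p1).
    rewrite -mul_mpolyC; apply: (@ev_inj _ o) => x.
    rewrite /al /be !evE [(w - u) 1 0]mxE [(w - u) 0 0]mxE.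
    by rewrite [(- u) 1 0]mxE [(- u) 0 0]mxE; field.
  by rewrite restrZ int01Z h0 mulr0.
have h1 : int01 (restr o (a 0) w al) = 0.
  have := h 1; rewrite /edge_vec.
  have -> : ordS (1 : 'I_3) = 2 by apply/val_inj.
  have -> : ord_pred (1 : 'I_3) = 0 by apply/val_inj.
  rewrite /= rev -/w => h1; have -> : al = (- D^-1) *:
     (mpolyC 2 ((a 0 - a 2) 1 0) * p0 - mpolyC 2 ((a 0 - a 2) 0 0) * p1).
    rewrite -mul_mpolyC; apply: (@ev_inj _ o) => x.
    by rewrite /al !evE /w !mxE; field.
  by rewrite restrZ int01Z h1 mulr0.
have h2 : int01 (restr o (a 0) u be) = 0.
  have := h 2; rewrite /edge_vec.
  have -> : ordS (2 : 'I_3) = 0 by apply/val_inj.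
  have -> : ord_pred (2 : 'I_3) = 1 by apply/val_inj.
  rewrite /= -/u => h2; have -> : be = (- D^-1) *:
     (mpolyC 2 (u 1 0) * p0 - mpolyC 2 (u 0 0) * p1).
    rewrite -mul_mpolyC; apply: (@ev_inj _ o) => x.
    by rewrite /be !evE; field.
  by rewrite restrZ int01Z h2 mulr0.
(* The edge opposite to [a 0] occurs in both formulas, with opposite orientations; after reversal
   the two terms add up to its flux. *)
have h3 : int01 (restr o (a 2) (u - w) be) = int01 (restr o (a 1) (w - u) be).
  have -> : w - u = a 2 - a 1 by rewrite /w /u opprB addrA subrK.
  by rewrite rev /w /u opprB addrA subrK.
rewrite tri_intD tri_int_deriv_u tri_int_deriv_w h1 h2 h3 !subr0 -mulrDr -int01D -restrD.
by rewrite h0 mulr0.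
Qed.

End Triangle.
End TriangleIntegral.

(** * Dimensions *)

Section Monomials.

Definition mnm2 (i j : nat) : multinom 2 := Multinom [tuple i; j].

Lemma mnm2E i j : mnm2 i j 0 = i /\ mnm2 i j 1 = j.
Proof. by split; rewrite mnm_tnth (tnth_nth 0%N). Qed.

Lemma mdeg_mnm2 i j : mdeg (mnm2 i j) = (i + j)%N.
Proof. by rewrite mdegE sum_I2; have [-> ->] := mnm2E i j. Qed.

Lemma mnm2_eta (c : multinom 2) : c = mnm2 (c 0) (c 1).
Proof.
by have [e0 e1] := mnm2E (c 0) (c 1); apply/mnmP => i; case: (I2_cases i) => ->; rewrite ?e0 ?e1.
Qed.

(* The monomials of degree [a], ..., [a + n - 1]. *)
Definition monomials (a n : nat) : seq (multinom 2) :=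
  [seq mnm2 i (d - i) | d <- iota a n, i <- iota 0 d.+1].

Lemma mem_monomials a n c : (c \in monomials a n) = (a <= mdeg c < a + n)%N.
Proof.
apply/allpairsPdep/idP => [[d [i [+ + ->]]]|h].
  by rewrite !mem_iota mdeg_mnm2 => ? ?; rewrite subnKC //; lia.
exists (mdeg c), (c 0); rewrite !mem_iota h; split => //.
  by rewrite mdegE sum_I2 /= add0n ltnS leq_addr.
by rewrite {1}(mnm2_eta c) mdegE sum_I2 addKn.
Qed.

Lemma uniq_monomials a n : uniq (monomials a n).
Proof.
apply: allpairs_uniq_dep => [|d _|]; rewrite ?iota_uniq //.
move=> [d i] [d' i'] /allpairsPdep[? [? [_ + [-> ->]]]] /allpairsPdep[? [? [_ + [-> ->]]]] /=.
rewrite !mem_iota /= => h h' e.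
have := congr1 (fun m : multinom 2 => m 0) e; have := congr1 (fun m : multinom 2 => m 1) e.
rewrite !(proj1 (mnm2E _ _)) !(proj2 (mnm2E _ _)) => e1 e0; subst.
by congr (existT _ _ _); lia.
Qed.

(** The sum of d + 1 over the degrees d, doubled to avoid a division in [nat]. *)
Lemma size_monomials a n : (2 * size (monomials a n) = n * (2 * a + n + 1))%N.
Proof.
elim: n a => [|n ih] a; first by rewrite mul0n.
have -> : size (monomials a n.+1) = (a.+1 + size (monomials a.+1 n))%N.
  by rewrite /monomials /= size_cat size_map size_iota.
by rewrite mulnDr ih; nia.
Qed.

End Monomials.

Section Dimension.
Variable R : realType.
Local Notation MP := (mpoly 2 R).

Lemma has_dim_direct_sum (V : lmodType R) (A B : set V) d d' :
  has_dim A d -> has_dim B d' -> direct_sum A B -> has_dim (sum_space A B) (d + d').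
Proof.
move=> [b [bfree ->]] [b' [b'free ->]] ds.
exists (fun i => match fintype.split i with inl j => b j | inr j => b' j end).
have sumE (c : 'I_(d + d') -> R) :
    \sum_i c i *: (match fintype.split i with inl j => b j | inr j => b' j end) =
    \sum_i c (lshift d' i) *: b i + \sum_i c (rshift d i) *: b' i.
  rewrite big_split_ord /=; congr (_ + _); apply: eq_bigr => i _.
    by have -> := unsplitK (inl i : 'I_d + 'I_d').
  by have -> := unsplitK (inr i : 'I_d + 'I_d').
split=> [c|].
  rewrite sumE => c0.
  have cA : \sum_i c (lshift d' i) *: b i = 0.
    suff : [set 0] (\sum_i c (lshift d' i) *: b i) by [].
    rewrite -ds; split; first by exists (fun i => c (lshift d' i)).
    exists (fun i => - c (rshift d i)) => //.
    by under eq_bigr do rewrite scaleNr; rewrite sumrN; apply/esym/eqP; rewrite -addr_eq0 c0.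
  have cB : \sum_i c (rshift d i) *: b' i = 0 by move: c0; rewrite cA add0r.
  move=> i; rewrite -(splitK i); case: (fintype.split i) => j /=.
    exact: (bfree _ cA).
  exact: (b'free _ cB).
apply/seteqP; split=> [_ [_ [c _ <-] [_ [c' _ <-] <-]]|_ [c _ <-]].
  exists (fun i => match fintype.split i with inl j => c j | inr j => c' j end) => //.
  rewrite sumE; congr (_ + _); apply: eq_bigr => i _.
    by have -> := unsplitK (inl i : 'I_d + 'I_d').
  by have -> := unsplitK (inr i : 'I_d + 'I_d').
rewrite sumE; exists (\sum_i c (lshift d' i) *: b i); first by exists (fun i => c (lshift d' i)).
by exists (\sum_i c (rshift d i) *: b' i) => //; exists (fun i => c (rshift d i)).
Qed.

Definition supported_in (s : seq (multinom 2)) : set MP :=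
  [set p | forall c, c \notin s -> mcoeff c p = 0].

(** The kernel of a differential operator is removed by deleting monomials: the space becomes an
    injective image of the span of those that remain, and its dimension is their number. *)
Lemma has_dim_supported (V : lmodType R) (f : MP -> V) (s : seq (multinom 2)) :
  uniq s -> (forall c p q, f (c *: p + q) = c *: f p + f q) ->
  (forall p, supported_in s p -> f p = 0 -> p = 0) ->
  has_dim (f @` supported_in s) (size s).
Proof.
move=> us flin finj.
have f0 : f 0 = 0.
  by have := flin (- 1) 0 0; rewrite scaler0 addr0 scaleN1r addNr.
pose m (i : 'I_(size s)) := tnth (in_tuple s) i.
have minj : injective m by apply/tuple_uniqP.
have fsum (c : 'I_(size s) -> R) :
    f (\sum_i c i *: mpolyX R (m i)) = \sum_i c i *: f (mpolyX R (m i)).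
  apply: (big_ind2 (fun p v => f p = v)) => // [p v q w <- <-|i _].
    by have := flin 1 p q; rewrite !scale1r.
  by have := flin (c i) (mpolyX R (m i)) 0; rewrite !addr0 f0 addr0.
have coefE (c : 'I_(size s) -> R) i : mcoeff (m i) (\sum_i c i *: mpolyX R (m i)) = c i.
  rewrite raddf_sum /= (bigD1 i) //= big1 ?addr0 => [|j ji].
    by rewrite mcoeffZ mcoeffX eqxx mulr1.
  by rewrite mcoeffZ mcoeffX (inj_eq minj) (negbTE ji) mulr0.
have coefN (c : 'I_(size s) -> R) : supported_in s (\sum_i c i *: mpolyX R (m i)).
  move=> k ks; rewrite raddf_sum big1 //= => i _; rewrite mcoeffZ mcoeffX.
  by case: eqP => [e|_]; rewrite ?mulr0 //; move: ks; rewrite -e mem_tnth.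
exists (fun i => f (mpolyX R (m i))); split=> [c|].
  by rewrite -fsum => /(finj _ (coefN c)) h i; rewrite -(coefE c i) h mcoeff0.
apply/seteqP; split=> [_ [p sp <-]|_ [c _ <-]].
  exists (fun i => mcoeff (m i) p) => //; rewrite -fsum; congr f.
  apply/mpolyP => k; have [ks|ks] := boolP (k \in s); last by rewrite coefN // sp.
  have /tnthP[i ->] : k \in in_tuple s by [].
  exact: coefE.
by exists (\sum_i c i *: mpolyX R (m i)) => //; exact: fsum.
Qed.

Lemma has_dim_Symmetric : has_dim (@Symmetric R) 3.
Proof.
pose b (i : 'I_3) : 'M[R]_2 := if i == 0 then delta_mx 0 0 else
  if i == 1 then delta_mx 1 1 else delta_mx 0 1 + delta_mx 1 0.
have bE (c : 'I_3 -> R) : \sum_i c i *: b i = \matrix_(i, j)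
    (if i == j then if i == 0 then c 0 else c 1 else c 2).
  rewrite sum_I3 /b /=; apply/matrixP => i j; rewrite !mxE.
  by case: (I2_cases i) => ->; case: (I2_cases j) => -> /=; ring.
exists b; split=> [c /[!bE] /matrixP h i|].
  have := h 0 0; have := h 1 1; have := h 0 1; rewrite !mxE /=.
  by case: (I3_cases i) => ->.
apply/seteqP; split=> [A /= sA|_ [c _ <-]].
  exists (fun i => if i == 0 then A 0 0 else if i == 1 then A 1 1 else A 0 1) => //.
  rewrite bE; apply/matrixP => i j; rewrite !mxE /=.
  case: (I2_cases i) => ->; case: (I2_cases j) => -> //=.
  by rewrite -{2}sA mxE.
by rewrite bE /=; apply/matrixP => i j; rewrite !mxE eq_sym; case: eqP => // ->.
Qed.

End Dimension.

(** * Symmetric polynomial fields as triples of polynomials *)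

Section SymmetricFields.
Variables (R : realType) (o : 'cV[R]_2).
Local Notation E := 'cV[R]_2.
Local Notation MP := (mpoly 2 R).
Local Notation "'x_ i" := (mpolyX R (mnm1 (i : 'I_2))) (at level 8, i at level 2).
Implicit Types p q v : MP.

(** Storing the off-diagonal entry once builds symmetry into the coding, and a zero field means
    three zero polynomials. *)
Definition evS (t00 t01 t11 : MP) : E -> 'M[R]_2 := fun x => \matrix_(i, j)
  ev o (if i == j then if i == 0 then t00 else t11 else t01) x.

Lemma evS_eq0 t00 t01 t11 : evS t00 t01 t11 = 0 -> [/\ t00 = 0, t01 = 0 & t11 = 0].
Proof.
move=> h; have h' x i j : evS t00 t01 t11 x i j = 0 by rewrite h mxE.
split; apply: (@ev_eq0 _ o) => x.
- by have := h' x 0 0; rewrite mxE.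
- by have := h' x 0 1; rewrite mxE.
- by have := h' x 1 1; rewrite mxE.
Qed.

Lemma evS_lin c t00 t01 t11 s00 s01 s11 :
  evS (c *: t00 + s00) (c *: t01 + s01) (c *: t11 + s11) =
  c *: evS t00 t01 t11 + evS s00 s01 s11.
Proof.
apply/funext => x; apply/matrixP => i j; rewrite !mxE.
have h p q : ev o (c *: p + q) x = c * ev o p x + ev o q x by rewrite -mul_mpolyC !evE.
by case: ifP => _ //; case: ifP.
Qed.

Definition symcurl v0 v1 := evS (mderiv 1 v0)
  (2^-1 *: (mderiv 1 v1 - mderiv 0 v0)) (- mderiv 0 v1).
Definition radial q := evS (q * 'x_0 * 'x_0) (q * 'x_0 * 'x_1) (q * 'x_1 * 'x_1).
Definition hess q := evS (mderiv 0 (mderiv 0 q)) (mderiv 0 (mderiv 1 q)) (mderiv 1 (mderiv 1 q)).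
Definition symperp v0 v1 := evS ('x_1 * v0) (2^-1 *: ('x_1 * v1 - 'x_0 * v0)) (- ('x_0 * v1)).

Lemma symcurl_lin c v0 v1 w0 w1 :
  symcurl (c *: v0 + w0) (c *: v1 + w1) = c *: symcurl v0 v1 + symcurl w0 w1.
Proof.
rewrite /symcurl -evS_lin !mderivD !mderivZ; congr evS; rewrite -!mul_mpolyC; ring.
Qed.

Lemma radial_lin c p q : radial (c *: p + q) = c *: radial p + radial q.
Proof. by rewrite /radial -evS_lin -!mul_mpolyC; congr evS; ring. Qed.

Lemma hess_lin c p q : hess (c *: p + q) = c *: hess p + hess q.
Proof. by rewrite /hess -evS_lin !(mderivD, mderivZ). Qed.

Lemma symperp_lin c v0 v1 w0 w1 :
  symperp (c *: v0 + w0) (c *: v1 + w1) = c *: symperp v0 v1 + symperp w0 w1.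
Proof. by rewrite /symperp -evS_lin -!mul_mpolyC; congr evS; ring. Qed.

Lemma vpolysP m (v : E -> E) : vpolys m v <-> exists v0 v1, [/\ (msize v0 <= m.+1)%N,
  (msize v1 <= m.+1)%N & v = fun x => \col_i ev o (if i == 0 then v0 else v1) x].
Proof.
split=> [h|[v0 [v1 [s0 s1 ->]]] i].
  have [v0 s0 v0E] := (polysP o m _).1 (h 0); have [v1 s1 v1E] := (polysP o m _).1 (h 1).
  exists v0, v1; split => //; apply/funext => x; apply/matrixP => i j; rewrite ord1 !mxE.
  by case: (I2_cases i) => -> /=; rewrite -?v0E -?v1E.
apply/(polysP o); exists (if i == 0 then v0 else v1); first by case: ifP.
by apply/funext => x; rewrite mxE.
Qed.

Lemma CspaceE l : Cspace l = [set t | exists v0 v1,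
  [/\ (msize v0 <= l.+2)%N, (msize v1 <= l.+2)%N & t = symcurl v0 v1]].
Proof.
have h v0 v1 : (fun x => sym (curlv (fun x => \col_i ev o (if i == 0 then v0 else v1) x) x))
    = symcurl v0 v1.
  apply/funext => x; apply/matrixP => i j; rewrite !mxE -mul_mpolyC.
  have e k : (fun y => (\col_i ev o (if i == 0 then v0 else v1) y) k 0) =
    ev o (if k == 0 then v0 else v1) by apply/funext => y; rewrite mxE.
  rewrite !e !partial_ev.
  by case: (I2_cases i) => ->; case: (I2_cases j) => -> /=; rewrite ?evE; field.
apply/seteqP; split=> [_ [v /vpolysP[v0 [v1 [s0 s1 ->]]] <-]|_ [v0 [v1 [s0 s1 ->]]]].
  by exists v0, v1.
by rewrite -h; exists (fun x => \col_i ev o (if i == 0 then v0 else v1) x) => //;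
   apply/vpolysP; exists v0, v1.
Qed.

Lemma CcomplE k : Ccompl o k = [set radial q | q in [set q | (msize q <= (k - 2).+1)%N]].
Proof.
have h q : (fun x => ev o q x *: ((x - o) *m (x - o)^T)) = radial q.
  apply/funext => x; apply/matrixP => i j; rewrite !mxE big_ord1 !mxE.
  by case: (I2_cases i) => ->; case: (I2_cases j) => -> /=; rewrite !evE; ring.
apply/seteqP; split=> [_ [f /(polysP o)[q sq ->] <-]|_ [q sq <-]]; first by exists q.
by rewrite -h; exists (ev o q) => //; apply/(polysP o); exists q.
Qed.

Lemma hessPE m : hessP m = [set hess q | q in [set q | (msize q <= m.+1)%N]].
Proof.
have h q : hessian (ev o q) = hess q.
  apply/funext => x; apply/matrixP => i j; rewrite !mxE !partial_ev.
  by case: (I2_cases i) => ->; case: (I2_cases j) => -> //=; rewrite mderiv_comm.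
apply/seteqP; split=> [_ [f /(polysP o)[q sq ->] <-]|_ [q sq <-]]; first by exists q.
by rewrite -h; exists (ev o q) => //; apply/(polysP o); exists q.
Qed.

Lemma symperpPE m : symperpP o m = [set t | exists v0 v1,
  [/\ (msize v0 <= m.+1)%N, (msize v1 <= m.+1)%N & t = symperp v0 v1]].
Proof.
have h v0 v1 : (fun x => sym (perp (x - o) *m (\col_i ev o (if i == 0 then v0 else v1) x)^T))
    = symperp v0 v1.
  apply/funext => x; apply/matrixP => i j; rewrite !mxE !big_ord1 !mxE -mul_mpolyC.
  by case: (I2_cases i) => ->; case: (I2_cases j) => -> /=; rewrite ?evE; field.
apply/seteqP; split=> [_ [v /vpolysP[v0 [v1 [s0 s1 ->]]] <-]|_ [v0 [v1 [s0 s1 ->]]]].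
  by exists v0, v1.
by rewrite -h; exists (fun x => \col_i ev o (if i == 0 then v0 else v1) x) => //;
   apply/vpolysP; exists v0, v1.
Qed.

(** The Euler operator annihilates [p], so every coefficient times its degree is zero. *)
Lemma mderiv_eq0 p : mderiv 0 p = 0 -> mderiv 1 p = 0 -> p = mpolyC 2 (mcoeff (@mnm0 2) p).
Proof.
move=> p0 p1; apply/mpolyP => c; rewrite mcoeffC.
case: eqVneq => [->|c0]; first by rewrite mulr1.
have : mcoeff c (euler p) = 0 by rewrite eulerE p0 p1 !mulr0 addr0 mcoeff0.
rewrite mcoeff_euler mulr0 => /eqP.
by rewrite mulf_eq0 pnatr_eq0 mdeg_eq0 (negbTE c0) => /eqP.
Qed.

(** The entries say that the mixed derivatives of v vanish and that [mderiv 0 v0 = mderiv 1 v1];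
    this common derivative then has zero gradient and is the constant [c]. *)
Lemma symcurl_eq0 v0 v1 : symcurl v0 v1 = 0 -> exists c b0 b1,
  v0 = mpolyC 2 c * 'x_0 + mpolyC 2 b0 /\ v1 = mpolyC 2 c * 'x_1 + mpolyC 2 b1.
Proof.
move/evS_eq0 => [h1 /eqP + /eqP]; rewrite scaler_eq0 invr_eq0 pnatr_eq0 /= subr_eq0 => /eqP h2.
rewrite oppr_eq0 => /eqP h3.
have cE : mderiv 0 v0 = mpolyC 2 (mcoeff (@mnm0 2) (mderiv 0 v0)).
  apply: mderiv_eq0; first by rewrite -h2 mderiv_comm h3 mderiv0.
  by rewrite mderiv_comm h1 mderiv0.
set c := mcoeff _ _ in cE.
have e0 : v0 - mpolyC 2 c * 'x_0 = mpolyC 2 (mcoeff (@mnm0 2) (v0 - mpolyC 2 c * 'x_0)).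
  apply: mderiv_eq0; rewrite mderivB mderiv_mulC mderivXU.
    by rewrite cE mulr1 subrr.
  by rewrite h1 mulr0 subrr.
have e1 : v1 - mpolyC 2 c * 'x_1 = mpolyC 2 (mcoeff (@mnm0 2) (v1 - mpolyC 2 c * 'x_1)).
  apply: mderiv_eq0; rewrite mderivB mderiv_mulC mderivXU.
    by rewrite h3 mulr0 subrr.
  by rewrite h2 cE mulr1 subrr.
exists c; do 2 eexists; split; apply/eqP; rewrite addrC -subr_eq.
  by rewrite {1}e0.
by rewrite {1}e1.
Qed.

Lemma symcurl_rigid c b0 b1 :
  symcurl (mpolyC 2 c * 'x_0 + mpolyC 2 b0) (mpolyC 2 c * 'x_1 + mpolyC 2 b1) = 0.
Proof.
rewrite /symcurl !mderivD !mderiv_mulC !mderivC !mderivXU /= mulr0 mulr1 !addr0 subrr scaler0 oppr0.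
by apply/funext => x; apply/matrixP => i j; rewrite !mxE !if_same -mpolyC0 evC.
Qed.

End SymmetricFields.

(** * Direct sums, kernels and dimension counts *)

Section Dimensions.
Variables (R : realType) (o : 'cV[R]_2).
Local Notation E := 'cV[R]_2.
Local Notation MP := (mpoly 2 R).
Local Notation "'x_ i" := (mpolyX R (mnm1 (i : 'I_2))) (at level 8, i at level 2).
Implicit Types p q v : MP.

Lemma evSD t00 t01 t11 s00 s01 s11 :
  evS o t00 t01 t11 + evS o s00 s01 s11 = evS o (t00 + s00) (t01 + s01) (t11 + s11).
Proof. by have := evS_lin o 1 t00 t01 t11 s00 s01 s11; rewrite !scale1r => ->. Qed.

Lemma mpolyX_neq0 i : 'x_i != 0 :> MP.
Proof.
apply/eqP => /mpolyP/(_ (mnm1 i)); rewrite mcoeffX eqxx mcoeff0.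
by move/eqP; rewrite oner_eq0.
Qed.

Definition divdiv t00 t01 t11 : MP :=
  mderiv 0 (mderiv 0 t00) + 2 *: mderiv 0 (mderiv 1 t01) + mderiv 1 (mderiv 1 t11).

Lemma divdivD t00 t01 t11 s00 s01 s11 : divdiv (t00 + s00) (t01 + s01) (t11 + s11) =
  divdiv t00 t01 t11 + divdiv s00 s01 s11.
Proof. by rewrite /divdiv !mderivD scalerDr; ring. Qed.

Lemma divdiv0 : divdiv 0 0 0 = 0.
Proof. by rewrite /divdiv !mderiv0 scaler0 !addr0. Qed.

Lemma divdiv_symcurl v0 v1 :
  divdiv (mderiv 1 v0) (2^-1 *: (mderiv 1 v1 - mderiv 0 v0)) (- mderiv 0 v1) = 0.
Proof.
rewrite /divdiv !(mderivZ, mderivB, mderivN) scalerA mulfV ?pnatr_eq0 // scale1r.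
rewrite (mderiv_comm 0 1 v0) (mderiv_comm 0 1 v1) (mderiv_comm 0 1 (mderiv 1 v1)); ring.
Qed.

Lemma divdiv_radial q : divdiv (q * 'x_0 * 'x_0) (q * 'x_0 * 'x_1) (q * 'x_1 * 'x_1) =
  euler (euler q + 2%:R *: q) + 3%:R *: (euler q + 2%:R *: q).
Proof.
apply: (@ev_inj _ o) => x.
rewrite /divdiv !eulerE -!mul_mpolyC !(mderivD, mderivM, mderivXU, mderivC).
rewrite (mderiv_comm 1 0 q) /= mpolyC0 mpolyC1 -mpolyC1 -mpolyC0 !evE; ring.
Qed.

Lemma quadform_hess q : 'x_0 * 'x_0 * mderiv 0 (mderiv 0 q)
  + 2%:R *: ('x_0 * 'x_1 * mderiv 0 (mderiv 1 q)) + 'x_1 * 'x_1 * mderiv 1 (mderiv 1 q)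
  = euler (euler q) - euler q.
Proof.
apply: (@ev_inj _ o) => x.
rewrite !eulerE -!mul_mpolyC !(mderivD, mderivM, mderivXU, mderivC).
rewrite (mderiv_comm 1 0 q) /= mpolyC0 mpolyC1 -mpolyC1 -mpolyC0 !evE; ring.
Qed.

Lemma divdiv_radial_eq0 q :
  divdiv (q * 'x_0 * 'x_0) (q * 'x_0 * 'x_1) (q * 'x_1 * 'x_1) = 0 -> q = 0.
Proof. by rewrite divdiv_radial => /euler_addn_eq0/euler_addn_eq0. Qed.

Lemma symcurl_radial_eq0 v0 v1 q : symcurl o v0 v1 + radial o q = 0 -> q = 0.
Proof.
rewrite evSD => /evS_eq0[h0 h1 h2]; apply: divdiv_radial_eq0.
by rewrite -[LHS]add0r -(divdiv_symcurl v0 v1) -divdivD h0 h1 h2 divdiv0 divdiv_symcurl.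
Qed.

(** The eigenvalue d (d - 1) of D (D - 1) is nonzero for d >= 2, so only an affine polynomial
    survives, and its Hessian is zero. *)
Lemma mcoeff_euler_idem q c : euler (euler q) = euler q -> (2 <= mdeg c)%N -> mcoeff c q = 0.
Proof.
move=> /mpolyP/(_ c); rewrite !mcoeff_euler => e c2.
have d0 : (mdeg c)%:R != 0 :> R by rewrite pnatr_eq0 -lt0n (leq_trans _ c2).
move/(mulfI d0)/eqP: e; rewrite -subr_eq0 -{2}[mcoeff c q]mul1r -mulrBl mulf_eq0 subr_eq0.
by rewrite pnatr_eq1 => /orP[/eqP c1|/eqP //]; rewrite c1 in c2.
Qed.

Lemma hess_eq0 q c : hess o q = 0 -> (2 <= mdeg c)%N -> mcoeff c q = 0.
Proof.
move=> /evS_eq0[h0 h1 h2]; apply: mcoeff_euler_idem; apply/eqP.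
by rewrite -subr_eq0 -quadform_hess h0 h1 h2 !mulr0 scaler0 !addr0.
Qed.

Lemma hess_symperp_eq0 q v0 v1 : hess o q + symperp o v0 v1 = 0 -> hess o q = 0.
Proof.
rewrite evSD => /evS_eq0[/eqP + /eqP + /eqP].
rewrite !addr_eq0 => /eqP h0 /eqP h1 /eqP h2.
have := quadform_hess q; rewrite h0 h1 h2.
have -> : 'x_0 * 'x_0 * - ('x_1 * v0) +
  2%:R *: ('x_0 * 'x_1 * - (2^-1 *: ('x_1 * v1 - 'x_0 * v0))) +
  'x_1 * 'x_1 * - - ('x_0 * v1) = 0.
  by apply: (@ev_inj _ o) => x; rewrite -!mul_mpolyC -mpolyC0 !evE; field.
move=> ee; have {}ee : euler (euler q) = euler q by apply/eqP; rewrite -subr_eq0 -ee.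
have qc := mcoeff_euler_idem ee.
have hq i j : mderiv i (mderiv j q) = 0.
  apply/mpolyP => c; rewrite !mcoeff_mderiv qc ?mul0rn ?mcoeff0 //.
  by rewrite !mdegD !mdeg1 !addn1.
rewrite /hess !hq; apply/funext => x; apply/matrixP => i j.
by rewrite !mxE !if_same -mpolyC0 evC.
Qed.

(** The diagonal entries ['x_1 * v0] and [- ('x_0 * v1)] suffice, the polynomial ring being a
    domain. *)
Lemma symperp_eq0 v0 v1 : symperp o v0 v1 = 0 -> v0 = 0 /\ v1 = 0.
Proof.
move=> /evS_eq0[/eqP + _ /eqP]; rewrite oppr_eq0 !mulf_eq0 !(negbTE (mpolyX_neq0 _)) /=.
by move=> /eqP -> /eqP ->.
Qed.

Lemma symcurl0 : symcurl o 0 0 = 0.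
Proof. by have := symcurl_lin o (-1) 0 0 0 0; rewrite !scaler0 !addr0 scaleN1r addNr. Qed.
Lemma radial0 : radial o 0 = 0.
Proof. by have := radial_lin o (-1) 0 0; rewrite !scaler0 !addr0 scaleN1r addNr. Qed.
Lemma hess0 : hess o 0 = 0.
Proof. by have := hess_lin o (-1) 0 0; rewrite !scaler0 !addr0 scaleN1r addNr. Qed.
Lemma symperp0 : symperp o 0 0 = 0.
Proof. by have := symperp_lin o (-1) 0 0 0 0; rewrite !scaler0 !addr0 scaleN1r addNr. Qed.

Lemma direct_sum_Cspace l k : direct_sum (Cspace l) (Ccompl o k).
Proof.
rewrite /direct_sum (CspaceE o) CcomplE; apply/seteqP; split=> [t [[v0 [v1 [_ _ ->]]] [q _ e]]|_ ->].
  have : symcurl o v0 v1 + radial o (- q) = 0.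
    have := radial_lin o (-1) q 0; rewrite addr0 scaleN1r radial0 addr0 => ->.
    by rewrite e scaleN1r subrr.
  move/symcurl_radial_eq0/eqP; rewrite oppr_eq0 => /eqP q0.
  by rewrite /= -e q0 radial0.
split; first by exists 0, 0; rewrite !msize0 symcurl0.
by exists 0; rewrite /= ?msize0 ?radial0.
Qed.

Lemma direct_sum_hessP m l : direct_sum (hessP m) (symperpP o l).
Proof.
rewrite /direct_sum (hessPE o) symperpPE; apply/seteqP.
split=> [t [[q _ e] [v0 [v1 [_ _ tE]]]]|_ ->].
  have h : hess o q = 0.
    apply: (@hess_symperp_eq0 q (- v0) (- v1)).
    have := symperp_lin o (-1) v0 v1 0 0; rewrite !addr0 !scaleN1r symperp0 addr0 => ->.
    by rewrite e tE subrr.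
  by rewrite /= -e h.
split; first by exists 0; rewrite /= ?msize0 ?hess0.
by exists 0, 0; rewrite !msize0 symperp0.
Qed.

Lemma supported_msize s p n : (forall c, c \in s -> (mdeg c < n)%N) ->
  supported_in s p -> (msize p <= n)%N.
Proof.
move=> sn sp; apply/msize_coefP => c nc; apply: sp; apply/negP => /sn.
by rewrite ltnNge nc.
Qed.

Lemma supported_monomials0 n p : supported_in (monomials 0 n) p <-> (msize p <= n)%N.
Proof.
split=> [|/msize_coefP sp c]; last by rewrite mem_monomials /= add0n -leqNgt; exact: sp.
by apply: supported_msize => c; rewrite mem_monomials.
Qed.

Lemma has_dim_Ccompl k : (2 <= k)%N -> has_dim (Ccompl o k) (size (monomials 0 k.-1)).
Proof.
move=> k2; rewrite CcomplE.
rewrite (_ : [set q | _] = supported_in (monomials 0 k.-1)); last first.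
  by apply/seteqP; split => q /=; rewrite supported_monomials0 -[k.-1]prednK ?subn2 //; lia.
apply: has_dim_supported (uniq_monomials _ _) _ _ => [c p q|q _ q0]; first exact: radial_lin.
by apply: (@symcurl_radial_eq0 0 0); rewrite symcurl0 q0 addr0.
Qed.

Lemma has_dim_symperpP m :
  has_dim (symperpP o m) (size (monomials 0 m.+1) + size (monomials 0 m.+1)).
Proof.
pose f p := symperp o p 0; pose g p := symperp o 0 p.
have fg p q : f p + g q = symperp o p q.
  by have := symperp_lin o 1 p 0 0 q; rewrite !scale1r addr0 add0r => ->.
have -> : symperpP o m = sum_space (f @` supported_in (monomials 0 m.+1))
   (g @` supported_in (monomials 0 m.+1)).
  rewrite symperpPE; apply/seteqP; split=> [_ [v0 [v1 [s0 s1 ->]]]|_ [_ [p hp <-] [_ [q hq <-] <-]]].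
    exists (f v0); first by exists v0 => //; exact/supported_monomials0.
    by exists (g v1) => //; exists v1 => //; exact/supported_monomials0.
  by exists p, q; split; rewrite ?fg //; exact/supported_monomials0.
apply: has_dim_direct_sum.
- apply: has_dim_supported (uniq_monomials _ _) _ _ => [c p q|q _ q0].
    by rewrite /f -symperp_lin scaler0 addr0.
  by have [] := symperp_eq0 q0.
- apply: has_dim_supported (uniq_monomials _ _) _ _ => [c p q|q _ q0].
    by rewrite /g -symperp_lin scaler0 addr0.
  by have [] := symperp_eq0 q0.
- apply/seteqP; split=> [_ [[p _ <-] [q _ e]]|_ ->].
    have : symperp o p (- q) = 0.
      rewrite -fg /g; have := symperp_lin o (-1) 0 q 0 0.
      by rewrite !scaler0 !addr0 !scaleN1r symperp0 addr0 -/(g q) e => ->; rewrite subrr.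
    by case/symperp_eq0 => -> _; rewrite /f /= symperp0.
  by split; exists 0; rewrite /f /g ?symperp0 // => c _; rewrite mcoeff0.
Qed.

Definition affine_part p : MP :=
  mpolyC 2 (mcoeff (@mnm0 2) p) + mpolyC 2 (mcoeff (mnm1 0) p) * 'x_0
  + mpolyC 2 (mcoeff (mnm1 1) p) * 'x_1.

Lemma mcoeff_sub_affine p c : (mdeg c < 2)%N -> mcoeff c (p - affine_part p) = 0.
Proof.
rewrite mcoeffB /affine_part !mcoeffD !mcoeffCM mcoeffC !mcoeffX.
case e : (mdeg c) => [|[|]] // _.
  move/eqP: e; rewrite mdeg_eq0 => /eqP ->.
  by rewrite eqxx !mnm1_eq0 !mulr0 !addr0 mulr1 subrr.
move/eqP: e => /mdeg1P[i /eqP ->]; rewrite mnm1_eq0 !eq_mnm1.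
by case: (I2_cases i) => -> /=; rewrite !(mulr0, mulr1, addr0, add0r) subrr.
Qed.

Lemma hess_affine p : hess o (affine_part p) = 0.
Proof.
have h i : mderiv i (affine_part p) = mpolyC 2 (mcoeff (mnm1 i) p).
  rewrite /affine_part !mderivD !mderiv_mulC !mderivXU mderivC.
  by case: (I2_cases i) => -> /=; rewrite ?mpolyC0 ?mpolyC1 ?mulr0 ?mulr1 ?addr0 ?add0r.
rewrite /hess !h !mderivC; apply/funext => x; apply/matrixP => i j.
by rewrite !mxE !if_same -mpolyC0 evC.
Qed.

(** Subtracting the affine part selects one potential for each Hessian, with monomials of degrees 2
    to m + 1 only. *)
Lemma has_dim_hessP m : has_dim (@hessP R m.+1) (size (monomials 2 m)).
Proof.
have sub p q : hess o (p - q) = hess o p - hess o q.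
  by have := hess_lin o (-1) q p; rewrite !scaleN1r addrC => ->; rewrite addrC.
have -> : hessP m.+1 = hess o @` supported_in (monomials 2 m).
  rewrite (hessPE o); apply/seteqP; split=> [_ [q /= sq <-]|_ [q sq <-]]; last first.
    exists q => //=; apply: supported_msize sq => c.
    by rewrite mem_monomials => /andP[_]; rewrite add2n.
  exists (q - affine_part q); last by rewrite sub hess_affine subr0.
  move=> c; rewrite mem_monomials negb_and -!ltnNge ltnS add2n => /orP[|mc].
    exact: mcoeff_sub_affine.
  rewrite mcoeffB /affine_part !mcoeffD !mcoeffCM mcoeffC !mcoeffX.
  move/msize_coefP: sq => ->; last by [].
  have h (c' : multinom 2) : (mdeg c' < 2)%N -> (c' == c) = false.
    by move=> c'2; apply/negP => /eqP e; move: mc; rewrite -e; lia.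
  by rewrite eq_sym !h ?mdeg0 ?mdeg1 // !mulr0 !addr0 subrr.
apply: has_dim_supported (uniq_monomials _ _) _ _ => [c p q|q hq q0]; first exact: hess_lin.
apply/mpolyP => c; rewrite mcoeff0.
have [c2|c2] := leqP 2 (mdeg c); first exact: hess_eq0.
by apply: hq; rewrite mem_monomials negb_and -ltnNge c2.
Qed.

(** A complement of the three-dimensional kernel is cut out by monomials: constants are dropped from
    both components, which removes b, and ['x_0] from the first one only, which removes c. *)
Lemma has_dim_Cspace l : has_dim (@Cspace R l)
  (size (rem (mnm1 0) (monomials 1 l.+1)) + size (monomials 1 l.+1)).
Proof.
pose f p := symcurl o p 0; pose g p := symcurl o 0 p.
have fg p q : f p + g q = symcurl o p q.
  by have := symcurl_lin o 1 p 0 0 q; rewrite !scale1r addr0 add0r => ->.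
set s0 := rem _ _; set s1 := monomials _ _.
have s0E c : (c \in s0) = (c != mnm1 0) && (c \in s1).
  by rewrite /s0 mem_rem_uniq ?uniq_monomials // inE.
have lt1 c : c \in s1 -> (mdeg c < l.+2)%N by rewrite mem_monomials => /andP[_]; rewrite add1n.
have lt0 c : c \in s0 -> (mdeg c < l.+2)%N by rewrite s0E => /andP[_]; exact: lt1.
have inj p q : supported_in s0 p -> supported_in s1 q -> symcurl o p q = 0 -> p = 0 /\ q = 0.
  move=> hp hq /symcurl_eq0[c [b0 [b1 [pE qE]]]].
  have s10 : @mnm0 2 \notin s1 by rewrite mem_monomials mdeg0.
  have : mcoeff (@mnm0 2) p = 0 by apply: hp; rewrite s0E negb_and s10 orbT.
  have : mcoeff (@mnm0 2) q = 0 by apply: hq.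
  have : mcoeff (mnm1 0) p = 0 by apply: hp; rewrite s0E eqxx.
  rewrite pE qE !mcoeffD !mcoeffCM !mcoeffX !mcoeffC !eqxx !mnm1_eq0.
  rewrite !(mulr0, mulr1, addr0, add0r) => -> -> ->.
  by rewrite mpolyC0 !mul0r !addr0.
have -> : Cspace l = sum_space (f @` supported_in s0) (g @` supported_in s1).
  rewrite (CspaceE o); apply/seteqP; split=> [_ [v0 [v1 [z0 z1 ->]]]|_ [_ [p hp <-] [_ [q hq <-] <-]]]; last first.
    by exists p, q; split; rewrite ?fg //; [exact: supported_msize hp|exact: supported_msize hq].
  (* These are the coefficients at the three deleted monomials; the kernel field that carries them
     is subtracted. *)
  pose c := mcoeff (mnm1 0) v0; pose b0 := mcoeff (@mnm0 2) v0; pose b1 := mcoeff (@mnm0 2) v1.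
  pose p := v0 - (mpolyC 2 c * 'x_0 + mpolyC 2 b0).
  pose q := v1 - (mpolyC 2 c * 'x_1 + mpolyC 2 b1).
  have -> : symcurl o v0 v1 = f p + g q.
    rewrite fg /p /q; have := symcurl_lin o (-1) (mpolyC 2 c * 'x_0 + mpolyC 2 b0)
      (mpolyC 2 c * 'x_1 + mpolyC 2 b1) v0 v1.
    by rewrite symcurl_rigid scaler0 add0r !scaleN1r [- _ + v0]addrC [- _ + v1]addrC => ->.
  have big (v : MP) d i b k : (msize v <= l.+2)%N -> (l.+2 <= mdeg k)%N ->
      mcoeff k (v - (mpolyC 2 d * 'x_i + mpolyC 2 b)) = 0.
    move=> /msize_coefP sv lk; rewrite mcoeffB mcoeffD mcoeffCM mcoeffX mcoeffC sv //.
    have -> : (k == @mnm0 2) = false by apply/negP => /eqP e; move: lk; rewrite e mdeg0.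
    have -> : (mnm1 i == k) = false by apply/negP => /eqP e; move: lk; rewrite -e mdeg1.
    by rewrite !mulr0 addr0 subrr.
  have s1N k : k \notin s1 -> k = @mnm0 2 \/ (l.+2 <= mdeg k)%N.
    rewrite mem_monomials negb_and -!ltnNge add1n !ltnS => /orP[|]; last by right.
    by rewrite leqn0 mdeg_eq0 => /eqP; left.
  exists (f p).
    exists p => // k; rewrite s0E negb_and negbK => /orP[/eqP ->|/s1N[->|/big]]; last exact.
      by rewrite /p mcoeffB mcoeffD mcoeffCM mcoeffX mcoeffC mnm1_eq0 eqxx mulr1 mulr0 addr0 subrr.
    by rewrite /p mcoeffB mcoeffD mcoeffCM mcoeffX mcoeffC mnm1_eq0 eqxx mulr1 mulr0 add0r subrr.
  exists (g q) => //; exists q => // k /s1N[->|/big]; last exact.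
  by rewrite /q mcoeffB mcoeffD mcoeffCM mcoeffX mcoeffC mnm1_eq0 eqxx mulr1 mulr0 add0r subrr.
have supp0 s : supported_in s (0 : MP) by move=> c _; rewrite mcoeff0.
apply: has_dim_direct_sum.
- apply: has_dim_supported => [|c p q|q hq q0].
  + by rewrite rem_uniq ?uniq_monomials.
  + by rewrite /f -symcurl_lin scaler0 addr0.
  + by have [] := inj q 0 hq (supp0 _) q0.
- apply: has_dim_supported (uniq_monomials _ _) _ _ => [c p q|q hq q0].
    by rewrite /g -symcurl_lin scaler0 addr0.
  by have [] := inj 0 q (supp0 _) hq q0.
- apply/seteqP; split=> [_ [[p hp <-] [q hq e]]|_ ->].
    have : symcurl o p (- q) = 0.
      rewrite -fg /g; have := symcurl_lin o (-1) 0 q 0 0.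
      by rewrite !scaler0 !addr0 !scaleN1r symcurl0 addr0 -/(g q) e => ->; rewrite subrr.
    move=> /(inj _ _ hp)[|-> _]; last by rewrite /f /= symcurl0.
    by move=> k ks; rewrite mcoeffN hq // oppr0.
  by split; exists 0; rewrite /f /g ?symcurl0.
Qed.

(** Both sides equal l^2 + 5 l + 3 + k (k - 1) / 2. *)
Lemma dimension_count k l : (3 <= k)%N -> (k - 1 <= l)%N ->
  (\sum_(v < 3) 3 + \sum_(e < 3) (l - 2).+1 + \sum_(e < 3) (l - 1).+1 +
   (size (monomials 2 (k - 3)) + (size (monomials 0 (l - 2).+1) + size (monomials 0 (l - 2).+1)))
   = size (rem (mnm1 (0%R : 'I_2)) (monomials 1 l.+1)) + size (monomials 1 l.+1) + size (monomials 0 k.-1))%N.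
Proof.
move=> k3 kl; rewrite size_rem; last by rewrite mem_monomials mdeg1.
have := size_monomials 2 (k - 3); have := size_monomials 0 (l - 2).+1.
have := size_monomials 1 l.+1; have := size_monomials 0 k.-1.
move: (size _) (size _) (size _) (size _) => a b c d.
rewrite !sum_nat_const !card_ord.
(* Shifting [k] and [l] removes the truncated subtractions and leaves polynomial arithmetic on the
   doubled counts. *)
have [k' ->] : exists k', k = k'.+3 by exists (k - 3)%N; lia.
have l2 : (2 <= l)%N by lia.
have [l' ->] : exists l', l = l'.+2 by exists (l - 2)%N; lia.
rewrite !subSS !subn0 /= => ha hb hc hd.
have b0 : (0 < b)%N by lia.
nia.
Qed.

End Dimensions.

(** * Edges *)

Section Edges.
Variables (R : realType) (a : 'I_3 -> 'cV[R]_2) (o : 'cV[R]_2).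
Hypothesis nc : noncollinear a.
Local Notation E := 'cV[R]_2.
Local Notation MP := (mpoly 2 R).
Implicit Types (e : 'I_3).

Lemma edge_paramE e s : edge_param a e s = a (ordS e) + s *: edge_vec a e.
Proof. by apply/matrixP => i j; rewrite !mxE; ring. Qed.

(** At every vertex this determinant is, up to sign, the doubled area of the triangle. *)
Lemma noncollinear_edge e :
  (a e - a (ordS e)) 0 0 * edge_vec a e 1 0 - (a e - a (ordS e)) 1 0 * edge_vec a e 0 0 != 0.
Proof.
have := noncollinear_det nc; apply: contraNneq; rewrite /edge_vec.
have S0 : ordS (0 : 'I_3) = 1 by apply/val_inj.
have S1 : ordS (1 : 'I_3) = 2 by apply/val_inj.
have S2 : ordS (2 : 'I_3) = 0 by apply/val_inj.
have P0 : ord_pred (0 : 'I_3) = 2 by apply/val_inj.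
have P1 : ord_pred (1 : 'I_3) = 0 by apply/val_inj.
have P2 : ord_pred (2 : 'I_3) = 1 by apply/val_inj.
by case: (I3_cases e) => ->; rewrite ?S0 ?S1 ?S2 ?P0 ?P1 ?P2 !mxE => h; apply/eqP/oppr_inj; rewrite oppr0 -[RHS]h; ring.
Qed.

Lemma edge_sqnorm e : edge_vec a e 0 0 ^+ 2 + edge_vec a e 1 0 ^+ 2 != 0.
Proof.
have := noncollinear_edge e; apply: contraNneq => /eqP.
by rewrite paddr_eq0 ?sqr_ge0 // !sqrf_eq0 => /andP[/eqP -> /eqP ->]; rewrite !mulr0 subrr.
Qed.

(** The affine function [lam] equals s at the point of parameter s of the edge, so substituting it
    for the variable of [P] extends [P] to the plane without raising the degree. *)
Lemma edge_lift e (P : {poly R}) m : (size P <= m.+1)%N ->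
  exists2 p : MP, (msize p <= m.+1)%N & forall s, ev o p (edge_param a e s) = P.[s].
Proof.
move=> sP; pose d := edge_vec a e.
pose lam := framecrd o (a (ordS e)) d (perp d).
have D0 : d 0 0 * perp d 1 0 - d 1 0 * perp d 0 0 != 0.
  by have := edge_sqnorm e; apply: contraNneq; rewrite !mxE /= => h; apply/eqP/oppr_inj; rewrite oppr0 -[RHS]h; ring.
have slam : (msize lam <= 2)%N.
  have h c i : (msize (mpolyC 2 c * mpolyX R (mnm1 i) : MP) <= 2)%N.
    by rewrite mul_mpolyC; apply: msizeZ_leq; rewrite msizeX mdeg1.
  apply: msizeB_leq => //; apply: msizeD_leq => //.
  by rewrite msizeC; case: (_ == _).
have elam s : ev o lam (edge_param a e s) = s.
  rewrite edge_paramE ev_framecrd // -/d.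
  move: (a (ordS e)) (d) D0 => b d' D0'; rewrite !mxE /= in D0' *; field; exact: D0'.
exists (\sum_(i < size P) mpolyC 2 P`_i * lam ^+ i).
  apply: (big_ind (fun q => msize q <= m.+1)%N); first by rewrite msize0.
    by move=> ? ?; apply: msizeD_leq.
  move=> i _; rewrite mul_mpolyC; apply: msizeZ_leq.
  have h k : (msize (lam ^+ k) <= k.+1)%N.
    by elim: k => [|k ih]; rewrite ?expr0 ?msize1 // exprS; exact: (@msizeM_leq _ _ _ 1 k).
  by apply: leq_trans (h i) _; apply: leq_trans sP; exact: ltn_ord.
move=> s; rewrite horner_coef.
apply: (big_ind2 (fun q v => ev o q (edge_param a e s) = v)).
- by rewrite -mpolyC0 evC.
- by move=> q v q' v' <- <-; rewrite evD.
move=> i _; rewrite evM evC; congr (_ * _).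
by elim: (i : nat) => [|k ih]; rewrite ?expr0 -?mpolyC1 ?evC // !exprS evM ih elam.
Qed.

Lemma edge_lift_poly e (P : {poly R}) m : (size P <= m.+1)%N ->
  exists p : MP, (msize p <= m.+1)%N /\ forall s, ev o p (edge_param a e s) = P.[s].
Proof. by move=> /(edge_lift e)[p sp pE]; exists p. Qed.

Lemma polys_on_restr e m (q : E -> R) : polys_on (edge a e) m q ->
  exists2 Q : {poly R}, (size Q <= m.+1)%N &
    forall s, 0 <= s <= 1 -> q (edge_param a e s) = Q.[s].
Proof.
move=> [_ /(polysP o)[p sp ->] <-]; exists (restr o (a (ordS e)) (edge_vec a e) p).
  exact: leq_trans (size_restr _ _ _ _) sp.
move=> s s01; rewrite patchT; last by rewrite inE; exists s => //=; rewrite in_itv.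
by rewrite horner_restr edge_paramE.
Qed.

Lemma restr_polys_on e m (Q : {poly R}) : (size Q <= m.+1)%N ->
  exists2 q, polys_on (edge a e) m q & forall s, 0 <= s <= 1 -> q (edge_param a e s) = Q.[s].
Proof.
move=> sQ; have [p sp pE] := edge_lift e sQ.
exists (ev o p \_ (edge a e)); first by exists (ev o p) => //; apply/(polysP o); exists p.
by move=> s s01; rewrite patchT ?pE // inE; exists s => //=; rewrite in_itv.
Qed.

(** The basis consists of lifts of the powers of s, cut off outside the edge. Two elements are equal
    as soon as their polynomials in s agree on ]0, 1[, hence coefficient by coefficient. *)
Lemma has_dim_polys_on e m : has_dim (polys_on (edge a e) m) m.+1.
Proof.
have hX (i : 'I_m.+1) : (size ('X^i : {poly R}) <= m.+1)%N by rewrite size_polyXn ltnS -ltnS.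
have /choice[b hb] (i : 'I_m.+1) := edge_lift_poly e (hX i).
have sumE (c : 'I_m.+1 -> R) s :
    ev o (\sum_i c i *: b i) (edge_param a e s) = (\poly_(i < m.+1) nth 0 (mkseq (fun k => c (inord k)) m.+1) i).[s].
  rewrite horner_poly; apply: (big_ind2 (fun q v => ev o q (edge_param a e s) = v)).
  - by rewrite -mpolyC0 evC.
  - by move=> q v q' v' <- <-; rewrite evD.
  move=> i _; rewrite nth_mkseq // inord_val -mul_mpolyC evM evC.
  by have [_ ->] := hb i; rewrite hornerXn.
have sumB (c : 'I_m.+1 -> R) :
    \sum_i c i *: (ev o (b i) \_ (edge a e)) = ev o (\sum_i c i *: b i) \_ (edge a e).
  apply: (big_ind2 (fun v q => v = ev o q \_ (edge a e))).
  - by apply/funext => x; rewrite /patch; case: ifP => // _; rewrite -mpolyC0 evC.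
  - move=> v q v' q' -> ->; apply/funext => x; rewrite fctE /patch; case: ifP => _; first by rewrite evD.
    by rewrite addr0.
  - move=> i _; apply/funext => x; rewrite fctE /patch; case: ifP => _; last by rewrite scaler0.
    by rewrite -mul_mpolyC evM evC.
have inE' s : 0 <= s <= 1 -> edge_param a e s \in edge a e.
  by move=> s01; rewrite inE; exists s => //=; rewrite in_itv.
exists (fun i => ev o (b i) \_ (edge a e)); split=> [c|].
  rewrite sumB => c0.
  have P0 : (\poly_(i < m.+1) nth 0 (mkseq (fun k => c (inord k)) m.+1) i) = 0.
    apply: poly_eq0_oo => s /andP[s0 s1]; rewrite -sumE.
    have := congr1 (fun f => f (edge_param a e s)) c0.
    by rewrite patchT // inE' // !ltW.
  move=> i; have := congr1 (fun P : {poly R} => P`_i) P0.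
  by rewrite coef_poly ltn_ord nth_mkseq // inord_val coef0.
apply/seteqP; split=> [q qe|_ [c _ <-]].
  have [Q sQ qQ] := polys_on_restr qe.
  exists (fun i => Q`_i) => //; rewrite sumB; apply/funext => x; rewrite /patch.
  have [|xe] := boolP (x \in edge a e); last first.
    by move: qe => [f _ <-]; rewrite patchC // in_setC.
  rewrite inE => -[s /=]; rewrite in_itv /= => s01 <-; rewrite sumE qQ // horner_poly.
  rewrite (horner_coef_wide _ sQ); apply: eq_bigr => i _.
  by rewrite nth_mkseq // inord_val.
rewrite sumB; exists (ev o (\sum_i c i *: b i)) => //.
apply/(polysP o); exists (\sum_i c i *: b i) => //.
apply: (big_ind (fun q => msize q <= m.+1)%N); first by rewrite msize0.
  by move=> ? ?; apply: msizeD_leq.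
by move=> i _; apply: msizeZ_leq; have [] := hb i.
Qed.

End Edges.

(** * Differential identities *)

Section Univariate.
Variable R : realType.
Implicit Types P Q : {poly R}.

Lemma deriv_eq0 P : P^`() = 0 -> P = (P.[0])%:P.
Proof.
move=> P0; rewrite horner_coef0.
apply/polyP => -[|i]; rewrite coefC //=; have := congr1 (fun Q : {poly R} => Q`_i) P0.
by rewrite coef_deriv coef0 => /eqP; rewrite mulrn_eq0 => /eqP.
Qed.

Lemma poly_moments_eq0 P m : (size P <= m)%N ->
  (forall Q, (size Q <= m)%N -> int01 (P * Q) = 0) -> P = 0.
Proof.
move=> sP h; have : P * P = 0.
  by apply: int01_eq0; [move=> s _; rewrite hornerM -expr2 sqr_ge0|exact: h].
by move/eqP; rewrite mulf_eq0 orbb => /eqP.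
Qed.

(** The roots split off as P = s (s - 1) P3, and P3 is small enough to be a test polynomial; then -
    P P3 = s (1 - s) P3^2 is nonnegative on [0, 1] with zero integral. *)
Lemma poly_bubble_moments_eq0 P m : (size P <= m.+2)%N -> P.[0] = 0 -> P.[1] = 0 ->
  (forall Q, (size Q <= m)%N -> int01 (P * Q) = 0) -> P = 0.
Proof.
move=> sP P0 P1 h.
have /factor_theorem[P2 PE] : root P 0 by apply/eqP.
have /factor_theorem[P3 P2E] : root P2 1.
  by apply/eqP; move: P1; rewrite PE hornerM hornerXsubC subr0 mulr1.
have [P30|P30] := eqVneq P3 0; first by rewrite PE P2E P30 !mul0r.
have sP3 : (size P3 <= m)%N.
  have n1 : P3 * ('X - 1%:P) != 0 by rewrite mulf_neq0 // polyXsubC_eq0.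
  by move: sP; rewrite PE P2E !size_Mmonic ?monicXsubC // !size_XsubC !addn2 /=.
have hP : P * P3 = 'X * ('X - 1) * (P3 * P3) by rewrite PE P2E subr0 mulrA; ring.
have : - 'X * ('X - 1) * (P3 * P3) = 0.
  apply: int01_eq0 => [s /andP[s0 s1]|].
    rewrite !hornerM hornerD !hornerN hornerX hornerC.
    by rewrite mulr_ge0 ?sqr_ge0 -?expr2 ?sqr_ge0 // mulNr -mulrN opprB mulr_ge0 // subr_ge0.
  by rewrite !mulNr -hP -scaleN1r int01Z h // mulr0.
move/eqP; rewrite !mulf_eq0 oppr_eq0 polyX_eq0 -polyC1 polyXsubC_eq0 orbb (negbTE P30).
by [].
Qed.

End Univariate.

(** * Traces and integration by parts as polynomial identities *)

Section Identities.
Variables (R : realType) (o : 'cV[R]_2).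
Local Notation E := 'cV[R]_2.
Local Notation MP := (mpoly 2 R).
Local Notation "'x_ i" := (mpolyX R (mnm1 (i : 'I_2))) (at level 8, i at level 2).
Implicit Types p q v t : MP.
Implicit Types n d : E.

Lemma ev0 x : ev o 0 x = 0. Proof. by rewrite -mpolyC0 evC. Qed.

Definition mdivE := (mdirderivE, mderivD, mderivM, mderivN, mderivXU, mderivC).

Lemma msize_mdirderiv d p m : (msize p <= m.+1)%N -> (msize (mdirderiv d p) <= m)%N.
Proof.
move=> sp; rewrite mdirderivE !mul_mpolyC.
by apply: msizeD_leq; apply: msizeZ_leq; apply: msize_mderiv.
Qed.

(** This and the next three are n^T tau n, t^T tau n, n^T div tau and the second edge trace, written
    in the entries of tau with t = (-n1, n0). *)
Definition nnM n t00 t01 t11 : MP := mpolyC 2 (n 0 0 ^+ 2) * t00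
  + mpolyC 2 (2 * n 0 0 * n 1 0) * t01 + mpolyC 2 (n 1 0 ^+ 2) * t11.

Definition tnM n t00 t01 t11 : MP := mpolyC 2 (- (n 0 0 * n 1 0)) * t00
  + mpolyC 2 (n 0 0 ^+ 2 - n 1 0 ^+ 2) * t01 + mpolyC 2 (n 0 0 * n 1 0) * t11.

Definition ndivM n t00 t01 t11 : MP := mpolyC 2 (n 0 0) * (mderiv 0 t00 + mderiv 1 t01)
  + mpolyC 2 (n 1 0) * (mderiv 0 t01 + mderiv 1 t11).

Definition etM n t00 t01 t11 : MP :=
  mdirderiv (tangent n) (tnM n t00 t01 t11) + ndivM n t00 t01 t11.

Definition frobM t00 t01 t11 s00 s01 s11 : MP := t00 * s00 + mpolyC 2 2%:R * (t01 * s01) + t11 * s11.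

Lemma ev_nnM_eq0 n t00 t01 t11 x : ev o t00 x = 0 -> ev o t01 x = 0 -> ev o t11 x = 0 ->
  ev o (nnM n t00 t01 t11) x = 0.
Proof. by rewrite /nnM !evE => -> -> ->; rewrite !mulr0 !addr0. Qed.

Lemma ev_tnM_eq0 n t00 t01 t11 x : ev o t00 x = 0 -> ev o t01 x = 0 -> ev o t11 x = 0 ->
  ev o (tnM n t00 t01 t11) x = 0.
Proof. by rewrite /tnM !evE => -> -> ->; rewrite !mulr0 !addr0. Qed.

Lemma tangentE n : tangent n 0 0 = - n 1 0 /\ tangent n 1 0 = n 0 0.
Proof. by rewrite !mxE /= opprK. Qed.

Lemma nn_traceE n t00 t01 t11 : nn_trace n (evS o t00 t01 t11) = ev o (nnM n t00 t01 t11).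
Proof.
apply/funext => x; rewrite /nn_trace !mxE sum_I2 !mxE !sum_I2 !mxE /= /nnM !evE; ring.
Qed.

Lemma edge_traceE n t00 t01 t11 : edge_trace n (evS o t00 t01 t11) = ev o (etM n t00 t01 t11).
Proof.
have [tg0 tg1] := tangentE n.
apply/funext => x; rewrite /edge_trace /etM evD; congr (_ + _).
  rewrite -derive_ev; congr ('D_ _ _ x); apply/funext => y.
  by rewrite !mxE sum_I2 !mxE !sum_I2 !mxE /= /tnM !evE; ring.
have e i j : (fun y => evS o t00 t01 t11 y i j) =
    ev o (if i == j then if i == 0 then t00 else t11 else t01).
  by apply/funext => y; rewrite mxE.
by rewrite mxE sum_I2 !mxE !sum_I2 !e !partial_ev /= /ndivM !evE.
Qed.

Lemma ip_triangleE (a : 'I_3 -> E) t00 t01 t11 s00 s01 s11 :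
  ip_triangle a (evS o t00 t01 t11) (evS o s00 s01 s11) =
  tri_int a o (frobM t00 t01 t11 s00 s01 s11).
Proof.
apply: eq_Rintegral => z _; rewrite /frob !sum_I2 !mxE /= /frobM !evE; ring.
Qed.

(** The scalar product n . v; on the pair of variables it is x . n. *)
Definition linM n v0 v1 : MP := mpolyC 2 (n 0 0) * v0 + mpolyC 2 (n 1 0) * v1.

Lemma nnM_Sigma n v0 v1 q :
  nnM n (mderiv 1 v0 + q * 'x_0 * 'x_0) (2^-1 *: (mderiv 1 v1 - mderiv 0 v0) + q * 'x_0 * 'x_1)
    (- mderiv 0 v1 + q * 'x_1 * 'x_1) =
  mdirderiv (tangent n) (linM n v0 v1) + linM n 'x_0 'x_1 * linM n 'x_0 'x_1 * q.
Proof.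
have [t0 t1] := tangentE n.
by apply: (@ev_inj _ o) => x; rewrite /nnM /linM -!mul_mpolyC !mdivE t0 t1 !(evE, ev0); field.
Qed.

(** An identity that holds only for unit n becomes a plain ring identity once the right multiple [Z]
    of 1 - |n|^2 is added. *)
Lemma eq_mod_zero c (A B Z : MP) : c = 0 -> A = B + mpolyC 2 c * Z -> A = B.
Proof. by move=> -> ->; rewrite mpolyC0 mul0r addr0. Qed.

(** In the radial part x . n factors out of both terms: t^T x x^T n = (x . t)(x . n), where d_t (x .
    n) = 0, and div (q x x^T) = (D q + 3 q) x. *)
Lemma etM_Sigma n v0 v1 q : n 0 0 ^+ 2 + n 1 0 ^+ 2 = 1 ->
  etM n (mderiv 1 v0 + q * 'x_0 * 'x_0) (2^-1 *: (mderiv 1 v1 - mderiv 0 v0) + q * 'x_0 * 'x_1)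
    (- mderiv 0 v1 + q * 'x_1 * 'x_1) =
  mdirderiv (tangent n) (mdirderiv (tangent n) (linM (tangent n) v0 v1))
  + linM n 'x_0 'x_1 * (mdirderiv (tangent n) (q * linM (tangent n) 'x_0 'x_1)
                        + euler q + mpolyC 2 3%:R * q).
Proof.
move=> n1; have [t0 t1] := tangentE n.
apply: (@eq_mod_zero (1 - (n 0 0 ^+ 2 + n 1 0 ^+ 2)) _ _
  (mpolyC 2 2^-1 * mdirderiv (tangent n) (mderiv 0 v0 + mderiv 1 v1))); first by rewrite n1 subrr.
apply: (@ev_inj _ o) => x; rewrite /etM /ndivM /tnM /linM eulerE -!mul_mpolyC !mdivE t0 t1 /=.
by rewrite !(mderiv_comm 0 1 v0) !(mderiv_comm 0 1 v1) !(evE, ev0); field.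
Qed.

(** The gradient of [p] is split into normal and tangential parts. Moving d_t off [p] in the
    tangential one completes the second trace and leaves a derivative along the edge, which
    integrates to end values. *)
Lemma flux_hess n k p t00 t01 t11 : n 0 0 ^+ 2 + n 1 0 ^+ 2 = 1 ->
  mpolyC 2 (k * n 0 0) * (p * (mderiv 0 t00 + mderiv 1 t01) - t00 * mderiv 0 p - t01 * mderiv 1 p)
  + mpolyC 2 (k * n 1 0) * (p * (mderiv 0 t01 + mderiv 1 t11) - t01 * mderiv 0 p - t11 * mderiv 1 p)
  = mpolyC 2 k * (p * etM n t00 t01 t11 - nnM n t00 t01 t11 * mdirderiv n p
                  - mdirderiv (tangent n) (p * tnM n t00 t01 t11)).
Proof.
move=> n1; have [t0 t1] := tangentE n.
apply: (@eq_mod_zero (1 - (n 0 0 ^+ 2 + n 1 0 ^+ 2)) _ _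
  (- (mpolyC 2 (k * n 0 0) * (t00 * mderiv 0 p + t01 * mderiv 1 p)
      + mpolyC 2 (k * n 1 0) * (t01 * mderiv 0 p + t11 * mderiv 1 p)))); first by rewrite n1 subrr.
  apply: (@ev_inj _ o) => x; rewrite /etM /ndivM /nnM /tnM !mdivE t0 t1 !(evE, ev0); ring.
Qed.

Lemma div_hess p t00 t01 t11 :
  p * divdiv t00 t01 t11 = (mderiv 0 (p * (mderiv 0 t00 + mderiv 1 t01) - t00 * mderiv 0 p - t01 * mderiv 1 p)
  + mderiv 1 (p * (mderiv 0 t01 + mderiv 1 t11) - t01 * mderiv 0 p - t11 * mderiv 1 p))
  + frobM t00 t01 t11 (mderiv 0 (mderiv 0 p)) (mderiv 0 (mderiv 1 p)) (mderiv 1 (mderiv 1 p)).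
Proof.
rewrite /divdiv /frobM -mul_mpolyC !(mderivD, mderivM, mderivN).
rewrite !(mderiv_comm 0 1 p) !(mderiv_comm 0 1 t01); ring.
Qed.

(** Against a symmetric field the symmetrization drops out, and the row-wise curl is adjoint to the
    row-wise rot up to a divergence. *)
Lemma div_symcurl v0 v1 s00 s01 s11 :
  frobM (mderiv 1 v0) (2^-1 *: (mderiv 1 v1 - mderiv 0 v0)) (- mderiv 0 v1) s00 s01 s11 =
  (mderiv 0 (- (v0 * s01 + v1 * s11)) + mderiv 1 (v0 * s00 + v1 * s01))
  + (v0 * (mderiv 0 s01 - mderiv 1 s00) + v1 * (mderiv 0 s11 - mderiv 1 s01)).
Proof.
apply: (@ev_inj _ o) => x.
by rewrite /frobM -mul_mpolyC !(mderivD, mderivM, mderivN) !evE; field.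
Qed.

(* The equations say rot (sym (x^perp (x) p)) = - w / 2; the left-hand side is
   - ((D + 3) p - x^perp rot p) / 2 with D the Euler operator, which is inverted by
   p = (D + 3)^-1 (w + x^perp g / 2), g = (D + 3)^-1 rot w. *)
Lemma rot_symperp_surj w0 w1 m : (msize w0 <= m.+1)%N -> (msize w1 <= m.+1)%N ->
  exists p0 p1, [/\ (msize p0 <= m.+1)%N, (msize p1 <= m.+1)%N,
    mderiv 0 (2^-1 *: ('x_1 * p1 - 'x_0 * p0)) - mderiv 1 ('x_1 * p0) = - (2^-1 *: w0) &
    mderiv 0 (- ('x_0 * p1)) - mderiv 1 (2^-1 *: ('x_1 * p1 - 'x_0 * p0)) = - (2^-1 *: w1)].
Proof.
move=> s0 s1.
have [g sg gE] := euler_addn_surj 2 (mderiv 0 w1 - mderiv 1 w0).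
have {}sg : (msize g <= m)%N.
  by apply: leq_trans sg _; apply: msizeB_leq; exact: msize_mderiv.
have sx i : (msize ('x_i * g) <= m.+1)%N.
  (* For [m = 0] a factor ['x_i] would break the bound; there [g] has size 0, so it is zero. *)
  case: m sg s0 s1 => [|m] sg _ _; last first.
    by apply: (@msizeM_leq _ _ _ 1 m) => //; rewrite msizeX mdeg1.
  by move: sg; rewrite leqn0 msize_poly_eq0 => /eqP ->; rewrite mulr0 msize0.
have [p0 sp0 p0E] := euler_addn_surj 2 (w0 + 2^-1 *: ('x_1 * g)).
have [p1 sp1 p1E] := euler_addn_surj 2 (w1 - 2^-1 *: ('x_0 * g)).
(* As rot (D + 3) = (D + 4) rot, rot (x^perp g) = - (D + 2) g and rot w = (D + 3) g, the operator D
   + 4 takes rot p to (D + 4) g / 2; it is injective. *)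
have rotp : mderiv 0 p1 - mderiv 1 p0 = 2^-1 *: g.
  apply/eqP; rewrite -subr_eq0; apply/eqP/(@euler_addn_eq0 R 3).
  have := congr1 (mderiv 0) p1E; have := congr1 (mderiv 1) p0E.
  rewrite !eulerE -!mul_mpolyC !mdivE /= mpolyC0 mpolyC1 => e0 e1.
  move: gE; rewrite eulerE -mul_mpolyC => gE.
  apply/eqP; rewrite -(subr0 (_ + _)).
  have z : mderiv 0 w1 - mderiv 1 w0 - ('x_0 * mderiv 0 g + 'x_1 * mderiv 1 g + mpolyC 2 3%:R * g) = 0.
    by rewrite gE subrr.
  apply/eqP; apply: (@ev_inj _ o) => x.
  have := congr1 (fun p => ev o p x) e0; have := congr1 (fun p => ev o p x) e1.
  have := congr1 (fun p => ev o p x) gE.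
  rewrite (mderiv_comm 0 1 p0) (mderiv_comm 0 1 p1) -!mpolyC0 -!mpolyC1 !evE => h1 h2 h3; lra.
exists p0, p1; split.
- by apply: leq_trans sp0 _; apply: msizeD_leq => //; apply: msizeZ_leq.
- by apply: leq_trans sp1 _; apply: msizeB_leq => //; apply: msizeZ_leq.
- apply: (@ev_inj _ o) => x.
  have := congr1 (fun p => ev o p x) p0E; have := congr1 (fun p => ev o p x) rotp.
  rewrite !eulerE -!mul_mpolyC !mdivE /= !(evE, ev0) => h1 h2; nra.
- apply: (@ev_inj _ o) => x.
  have := congr1 (fun p => ev o p x) p1E; have := congr1 (fun p => ev o p x) rotp.
  rewrite !eulerE -!mul_mpolyC !mdivE /= !(evE, ev0) => h1 h2; nra.
Qed.

End Identities.

(** * Unisolvence *)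

Section Unisolvence.
Variables (R : realType) (a : 'I_3 -> 'cV[R]_2) (o : 'cV[R]_2) (n : 'I_3 -> 'cV[R]_2).
Hypothesis nc : noncollinear a.
Hypothesis nP : forall e, outward_unit_normal a e (n e).
Local Notation E := 'cV[R]_2.
Local Notation MP := (mpoly 2 R).
Local Notation "'x_ i" := (mpolyX R (mnm1 (i : 'I_2))) (at level 8, i at level 2).
Local Notation "'r_ e" := (restr o (a (ordS e)) (edge_vec a e)) (at level 8, e at level 2).
Implicit Types (p q v t w : MP) (e : 'I_3).

Lemma n_norm e : n e 0 0 ^+ 2 + n e 1 0 ^+ 2 = 1.
Proof. by have [+ _ _] := nP e; rewrite /dot !mxE sum_I2 !mxE. Qed.

Lemma n_orth e : n e 0 0 * edge_vec a e 0 0 + n e 1 0 * edge_vec a e 1 0 = 0.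
Proof. by have [_ + _] := nP e; rewrite /dot !mxE sum_I2 !mxE. Qed.

(* The edge vector is [kap e] times the unit tangent. *)
Definition kap e : R := n e 0 0 * edge_vec a e 1 0 - n e 1 0 * edge_vec a e 0 0.

Lemma kap0 e : edge_vec a e 0 0 = - (kap e * n e 1 0).
Proof.
have n1 := n_norm e; have n0 := n_orth e; rewrite /kap.
rewrite -[LHS]mul1r -n1.
by transitivity (n e 0 0 * (n e 0 0 * edge_vec a e 0 0 + n e 1 0 * edge_vec a e 1 0)
  - (n e 0 0 * edge_vec a e 1 0 - n e 1 0 * edge_vec a e 0 0) * n e 1 0);
  [ring|rewrite n0 mulr0 sub0r].
Qed.

Lemma kap1 e : edge_vec a e 1 0 = kap e * n e 0 0.
Proof.
have n1 := n_norm e; have n0 := n_orth e; rewrite /kap.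
rewrite -[LHS]mul1r -n1.
by transitivity (n e 1 0 * (n e 0 0 * edge_vec a e 0 0 + n e 1 0 * edge_vec a e 1 0)
  + (n e 0 0 * edge_vec a e 1 0 - n e 1 0 * edge_vec a e 0 0) * n e 0 0);
  [ring|rewrite n0 mulr0 add0r].
Qed.

Lemma kap_neq0 e : kap e != 0.
Proof.
have := edge_sqnorm nc e; apply: contraNneq => k0.
by rewrite kap0 kap1 k0 !mul0r oppr0 expr0n addr0.
Qed.

Lemma mdirderiv_edge e p : mdirderiv (edge_vec a e) p = mpolyC 2 (kap e) * mdirderiv (tangent (n e)) p.
Proof.
have [t0 t1] := tangentE (n e).
apply: (@ev_inj _ o) => x; rewrite !mdirderivE t0 t1 kap0 kap1 !evE; ring.
Qed.

Lemma restr_edge0 e p : ('r_ e p).[0] = ev o p (a (ordS e)).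
Proof. by rewrite horner_restr scale0r addr0. Qed.

Lemma restr_edge1 e p : ('r_ e p).[1] = ev o p (a (ord_pred e)).
Proof. by rewrite horner_restr scale1r /edge_vec addrC subrK. Qed.

Lemma restr_linM_normal e : exists c, 'r_ e (linM (n e) 'x_0 'x_1) = c%:P.
Proof.
eexists; apply: deriv_eq0; rewrite deriv_restr /linM mdirderivD !mdirderivM !mdirderivC.
by rewrite !mdirderivX !mul0r !add0r -!mpolyCM -mpolyCD n_orth restrC polyC0.
Qed.

Lemma ip_edge_int01 e p (q : E -> R) (Q : {poly R}) :
  (forall s, 0 <= s <= 1 -> q (edge_param a e s) = Q.[s]) ->
  ip_edge a e (ev o p) q = 0 -> int01 ('r_ e p * Q) = 0.
Proof.
move=> qQ /eqP; rewrite /ip_edge mulf_eq0 => /orP[|/eqP h].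
  have h := edge_sqnorm nc e.
  have -> : dot (edge_vec a e) (edge_vec a e) = edge_vec a e 0 0 ^+ 2 + edge_vec a e 1 0 ^+ 2.
    by rewrite /dot !mxE sum_I2 !mxE !expr2.
  by rewrite sqrtr_eq0 le_eqVlt (negbTE h) /= ltNge addr_ge0 // sqr_ge0.
rewrite -[RHS]h; apply: eq_Rintegral => s; rewrite inE /= in_itv /= => s01.
by rewrite hornerM horner_restr qQ // edge_paramE.
Qed.

(** * Fields with vanishing vertex values, traces and Hessian moments *)

Section Traces.
Variables (k l : nat).
Hypotheses (k3 : (3 <= k)%N) (kl : (k - 1 <= l)%N).
Variables (v0 v1 q : MP).
Hypotheses (sv0 : (msize v0 <= l.+2)%N) (sv1 : (msize v1 <= l.+2)%N) (sq : (msize q <= k.-1)%N).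

Let T00 := mderiv 1 v0 + q * 'x_0 * 'x_0.
Let T01 := 2^-1 *: (mderiv 1 v1 - mderiv 0 v0) + q * 'x_0 * 'x_1.
Let T11 := - mderiv 0 v1 + q * 'x_1 * 'x_1.
Let tau := evS o T00 T01 T11.

Hypothesis vertex0 : forall i, tau (a i) = 0.
Hypothesis nn0 : forall e g, polys_on (edge a e) (l - 2) g -> ip_edge a e (nn_trace (n e) tau) g = 0.
Hypothesis et0 : forall e g, polys_on (edge a e) (l - 1) g -> ip_edge a e (edge_trace (n e) tau) g = 0.

Let l2 : (2 <= l)%N. Proof. by have := k3; have := kl; lia. Qed.

Lemma msize_linM d w0 w1 m : (msize w0 <= m)%N -> (msize w1 <= m)%N -> (msize (linM d w0 w1) <= m)%N.
Proof. by move=> s0 s1; rewrite /linM !mul_mpolyC; apply: msizeD_leq; apply: msizeZ_leq. Qed.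

Lemma vertexT i : [/\ ev o T00 (a i) = 0, ev o T01 (a i) = 0 & ev o T11 (a i) = 0].
Proof.
have h j k' : tau (a i) j k' = 0 by rewrite vertex0 mxE.
split.
- by have := h 0 0; rewrite /tau mxE.
- by have := h 0 1; rewrite /tau mxE.
- by have := h 1 1; rewrite /tau mxE.
Qed.

Lemma vertex_nnM i d : ev o (nnM d T00 T01 T11) (a i) = 0.
Proof.
by have [] := vertexT i; exact: ev_nnM_eq0.
Qed.

Lemma vertex_tnM i d : ev o (tnM d T00 T01 T11) (a i) = 0.
Proof.
by have [] := vertexT i; exact: ev_tnM_eq0.
Qed.

(** A polynomial of degree l is tested in degree l - 2 only; the two missing conditions are its
    values at the ends, which are vertices. *)
Lemma restr_nnM e : 'r_ e (nnM (n e) T00 T01 T11) = 0.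
Proof.
apply: (@poly_bubble_moments_eq0 _ _ (l - 2).+1).
- rewrite /T00 /T01 /T11 (nnM_Sigma o) restrD !restrM; have [c ->] := restr_linM_normal e.
  rewrite -polyCM mul_polyC; apply: leq_trans (size_polyD _ _) _; rewrite geq_max; apply/andP; split.
    apply: leq_trans (size_restr _ _ _ _) _.
    have -> : (l - 2).+3 = l.+1 by have := l2; lia.
    by apply: msize_mdirderiv; apply: msize_linM.
  apply: leq_trans (size_scale_leq _ _) _; apply: leq_trans (size_restr _ _ _ _) _.
  by apply: leq_trans sq _; have := l2; have := kl; lia.
- by rewrite restr_edge0 vertex_nnM.
- by rewrite restr_edge1 vertex_nnM.
move=> Q sQ; have [g gP gQ] := restr_polys_on o nc e sQ.
by apply: (ip_edge_int01 gQ); rewrite -nn_traceE; exact: nn0.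
Qed.

(** No end values are needed: v, of degree l + 1, is differentiated twice, and l >= k - 1 brings the
    radial part, of degree k - 2 on the edge, down to the degree l - 1 of the tests. *)
Lemma restr_etM e : 'r_ e (etM (n e) T00 T01 T11) = 0.
Proof.
apply: (@poly_moments_eq0 _ _ (l - 1).+1).
- have -> : (l - 1).+1 = l by have := l2; lia.
  have kl' : (k.-1 <= l)%N by have := kl; lia.
  rewrite /T00 /T01 /T11 (etM_Sigma o) ?n_norm // restrD !restrM; have [c ->] := restr_linM_normal e.
  rewrite mul_polyC; apply: leq_trans (size_polyD _ _) _; rewrite geq_max; apply/andP; split.
    apply: leq_trans (size_restr _ _ _ _) _.
    by do 2 apply: msize_mdirderiv; apply: msize_linM.
  apply: leq_trans (size_scale_leq _ _) _; apply: leq_trans (size_restr _ _ _ _) _.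
  apply: leq_trans kl'; apply: msizeD_leq; last by rewrite mul_mpolyC; apply: msizeZ_leq.
  apply: msizeD_leq; last exact: msize_euler.
  apply: msize_mdirderiv.
  have [k' kE] : exists k', k.-1 = k'.+1 by exists (k - 2)%N; have := k3; lia.
  rewrite kE mulrC; apply: (@msizeM_leq _ _ _ 1 k'); last by rewrite -kE.
  by apply: msize_linM; rewrite msizeX mdeg1.
move=> Q sQ; have [g gP gQ] := restr_polys_on o nc e sQ.
by apply: (ip_edge_int01 gQ); rewrite -edge_traceE; exact: et0.
Qed.

(** Both traces vanish on every edge, and the remaining boundary term is a difference of values of p
    t^T tau n at vertices, where tau is zero. *)
Lemma tri_int_div_hess p : tri_int a o (p * divdiv T00 T01 T11) =
  tri_int a o (frobM T00 T01 T11 (mderiv 0 (mderiv 0 p)) (mderiv 0 (mderiv 1 p)) (mderiv 1 (mderiv 1 p))).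
Proof.
rewrite div_hess (tri_intD _ nc) (tri_int_div_eq0 nc) ?add0r // => e d.
rewrite /d kap1 kap0 mpolyCN mulNr opprK (flux_hess o) ?n_norm //.
rewrite !mulrBr -mdirderiv_edge !restrB !restrM restr_nnM restr_etM !(mulr0, mul0r) subr0 sub0r.
rewrite -deriv_restr -scaleN1r int01Z int01_deriv restr_edge0 restr_edge1.
by rewrite !evM !vertex_tnM !mulr0 subrr mulr0.
Qed.

Hypothesis hess0 : forall p, (msize p <= k.-1)%N -> tri_int a o (frobM T00 T01 T11
  (mderiv 0 (mderiv 0 p)) (mderiv 0 (mderiv 1 p)) (mderiv 1 (mderiv 1 p))) = 0.

(** div div tau depends on [q] alone and has degree at most k - 2, so it may be taken as the
    potential p itself; its square then has zero integral. *)
Lemma radial_part_eq0 : q = 0.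
Proof.
have dT : divdiv T00 T01 T11 = divdiv (q * 'x_0 * 'x_0) (q * 'x_0 * 'x_1) (q * 'x_1 * 'x_1).
  by rewrite /T00 /T01 /T11 divdivD divdiv_symcurl add0r.
apply: (@divdiv_radial_eq0 _ o); rewrite -dT; set p := divdiv _ _ _.
have sp : (msize p <= k.-1)%N.
  rewrite /p dT (divdiv_radial o); have sE : (msize (euler q + 2%:R *: q) <= k.-1)%N.
    by apply: msizeD_leq; [exact: msize_euler|exact: msizeZ_leq].
  by apply: msizeD_leq; [exact: msize_euler|exact: msizeZ_leq].
have : p * p = 0.
  apply: (tri_int_ge0_eq0 nc (o := o)) => [x _|]; first by rewrite evM -expr2 sqr_ge0.
  by rewrite tri_int_div_hess hess0.
by move/eqP; rewrite mulf_eq0 orbb => /eqP.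
Qed.

Lemma restr_dn e : 'r_ e (mdirderiv (edge_vec a e) (linM (n e) v0 v1)) = 0.
Proof.
have := restr_nnM e; rewrite /T00 /T01 /T11 (nnM_Sigma o) {1}radial_part_eq0 mulr0 addr0 => h.
by rewrite mdirderiv_edge restrM h mulr0.
Qed.

Lemma restr_dtt e :
  'r_ e (mdirderiv (edge_vec a e) (mdirderiv (edge_vec a e) (linM (tangent (n e)) v0 v1))) = 0.
Proof.
have := restr_etM e; rewrite /T00 /T01 /T11 (etM_Sigma o) ?n_norm // {1 2 3}radial_part_eq0.
rewrite euler0 mul0r -{1}mpolyC0 mdirderivC !mulr0 !addr0 mulr0 addr0 => h.
by rewrite (mdirderiv_edge _ (linM _ _ _)) mdirderivM mdirderivC mul0r add0r mdirderiv_edge !restrM h !mulr0.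
Qed.

(** With the radial part gone, tau = 0 at a vertex means that the gradient of v is there a multiple
    of the identity. *)
Lemma vertex_grad i : [/\ ev o (mderiv 1 v0) (a i) = 0, ev o (mderiv 0 v1) (a i) = 0 &
  ev o (mderiv 1 v1) (a i) = ev o (mderiv 0 v0) (a i)].
Proof.
have [] := vertexT i; rewrite /T00 /T01 /T11 radial_part_eq0 !mul0r !addr0 -mul_mpolyC !evE.
move=> h0 h1 h2; split; first exact: h0.
  by apply/eqP; rewrite -oppr_eq0 h2.
by apply/eqP; rewrite -subr_eq0; move/eqP: h1; rewrite mulf_eq0 invr_eq0 pnatr_eq0.
Qed.

Lemma dt_vertex i e : ev o (mdirderiv (edge_vec a e) (linM (tangent (n e)) v0 v1)) (a i) =
  kap e * ev o (mderiv 0 v0) (a i).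
Proof.
have [h0 h1 h2] := vertex_grad i; have [t0 t1] := tangentE (n e).
rewrite mdirderiv_edge evM evC /linM !mdivE t0 t1 !(evE, ev0) h0 h1 h2; congr (_ * _).
by rewrite -[RHS]mul1r -(n_norm e); ring.
Qed.

Lemma restr_dt e : 'r_ e (mdirderiv (edge_vec a e) (linM (tangent (n e)) v0 v1)) =
  (kap e * ev o (mderiv 0 v0) (a (ordS e)))%:P.
Proof.
rewrite -dt_vertex -restr_edge0; apply: deriv_eq0.
by rewrite deriv_restr restr_dtt.
Qed.

Let c0 := ev o (mderiv 0 v0) (a 0).

Lemma eq_vertices (f : 'I_3 -> R) : (forall e, f (ordS e) = f (ord_pred e)) -> forall i, f i = f 0.
Proof.
move=> h; have := h 0; have := h 2.
have -> : ordS (0 : 'I_3) = 1 by apply/val_inj.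
have -> : ordS (2 : 'I_3) = 0 by apply/val_inj.
have -> : ord_pred (0 : 'I_3) = 2 by apply/val_inj.
have -> : ord_pred (2 : 'I_3) = 1 by apply/val_inj.
by move=> h2 h0 i; case: (I3_cases i) => -> //; rewrite -?h0 -?h2.
Qed.

(** The constant value of d_t (v . t) on an edge can be read at either end, which identifies the
    multiples at its two vertices. *)
Lemma vertex_div i : ev o (mderiv 0 v0) (a i) = c0.
Proof.
apply: (eq_vertices (f := fun i => ev o (mderiv 0 v0) (a i))) => e.
apply: (mulfI (kap_neq0 e)); rewrite -(dt_vertex (ord_pred e)) -restr_edge1 restr_dt.
by rewrite hornerC.
Qed.

(** In the basis n, t of the edge, v has derivative c0 t along t, exactly like c0 x. *)
Lemma restr_deriv_v e :
  'r_ e (mdirderiv (edge_vec a e) (v0 - mpolyC 2 c0 * 'x_0)) = 0 /\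
  'r_ e (mdirderiv (edge_vec a e) (v1 - mpolyC 2 c0 * 'x_1)) = 0.
Proof.
have [t0 t1] := tangentE (n e); have n1 := n_norm e.
have e0 : v0 = mpolyC 2 (n e 0 0) * linM (n e) v0 v1 - mpolyC 2 (n e 1 0) * linM (tangent (n e)) v0 v1.
  apply: (@ev_inj _ o) => x; rewrite /linM t0 t1 !evE -[LHS]mul1r -n1; ring.
have e1 : v1 = mpolyC 2 (n e 1 0) * linM (n e) v0 v1 + mpolyC 2 (n e 0 0) * linM (tangent (n e)) v0 v1.
  apply: (@ev_inj _ o) => x; rewrite /linM t0 t1 !evE -[LHS]mul1r -n1; ring.
have dc d p c : mdirderiv d (mpolyC 2 c * p) = mpolyC 2 c * mdirderiv d p.
  by rewrite mdirderivM mdirderivC mul0r add0r.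
have dB d p p' : mdirderiv d (p - p') = mdirderiv d p - mdirderiv d p'.
  by rewrite !mdirderivE !mderivB; ring.
split; rewrite dB (dc _ 'x_ _) mdirderivX restrB restrM !restrC.
  rewrite {1}e0 dB !dc restrB !restrM !restrC restr_dn restr_dt vertex_div mulr0 sub0r.
  by rewrite kap0 -!polyCM -polyCN -polyCB; congr (_%:P); ring.
rewrite {1}e1 mdirderivD !dc restrD !restrM !restrC restr_dn restr_dt vertex_div mulr0 add0r.
by rewrite kap1 -!polyCM -polyCB; congr (_%:P); ring.
Qed.

Lemma restr_const p : (forall e, 'r_ e (mdirderiv (edge_vec a e) p) = 0) ->
  forall e, 'r_ e (p - mpolyC 2 (ev o p (a 0))) = 0.
Proof.
move=> h e; have hc e' : 'r_ e' p = (ev o p (a (ordS e')))%:P.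
  by rewrite -restr_edge0; apply: deriv_eq0; rewrite deriv_restr h.
have hv := eq_vertices (f := fun i => ev o p (a i)) _.
rewrite restrB hc restrC hv ?subrr // => e'.
by rewrite -restr_edge1 hc hornerC.
Qed.

Lemma rigid_normalisation : exists w0 w1, [/\ (msize w0 <= l.+2)%N, (msize w1 <= l.+2)%N,
  symcurl o v0 v1 = symcurl o w0 w1 & forall e, 'r_ e w0 = 0 /\ 'r_ e w1 = 0].
Proof.
pose u0 := v0 - mpolyC 2 c0 * 'x_0; pose u1 := v1 - mpolyC 2 c0 * 'x_1.
pose b0 := ev o u0 (a 0); pose b1 := ev o u1 (a 0).
have sz v b i : (msize v <= l.+2)%N -> (msize (v - mpolyC 2 c0 * 'x_i - mpolyC 2 b) <= l.+2)%N.
  move=> sv; apply: msizeB_leq; first apply: msizeB_leq => //.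
    by rewrite mul_mpolyC; apply: msizeZ_leq; rewrite msizeX mdeg1.
  by rewrite msizeC; case: (_ == _).
exists (u0 - mpolyC 2 b0), (u1 - mpolyC 2 b1); split; [exact: sz|exact: sz| |].
  have := symcurl_lin o (-1) (mpolyC 2 c0 * 'x_0 + mpolyC 2 b0) (mpolyC 2 c0 * 'x_1 + mpolyC 2 b1) v0 v1.
  rewrite symcurl_rigid scaler0 add0r !scaleN1r => <-.
  by congr symcurl; rewrite /u0 /u1; ring.
move=> e; split; apply: restr_const => e'; first by have [] := restr_deriv_v e'.
by have [] := restr_deriv_v e'.
Qed.

End Traces.

(** * Barycentric coordinates and the cubic bubble *)

Definition lam e : MP := framecrd o (a (ordS e)) (a e - a (ordS e)) (edge_vec a e).

Lemma ev_lam e (c : 'I_3 -> R) : c 0 + c 1 + c 2 = 1 ->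
  ev o (lam e) (c 0 *: a 0 + c 1 *: a 1 + c 2 *: a 2) = c e.
Proof.
move=> c1; have D0 := noncollinear_edge nc e.
rewrite /lam ev_framecrd //; apply: (canLR (mulfK D0)).
have {c1} c0E : c 0 = 1 - c 1 - c 2 by rewrite -c1; ring.
rewrite /edge_vec.
have S0 : ordS (0 : 'I_3) = 1 by apply/val_inj.
have S1 : ordS (1 : 'I_3) = 2 by apply/val_inj.
have S2 : ordS (2 : 'I_3) = 0 by apply/val_inj.
have P0 : ord_pred (0 : 'I_3) = 2 by apply/val_inj.
have P1 : ord_pred (1 : 'I_3) = 0 by apply/val_inj.
have P2 : ord_pred (2 : 'I_3) = 1 by apply/val_inj.
by case: (I3_cases e) => ->; rewrite ?S0 ?S1 ?S2 ?P0 ?P1 ?P2 !mxE c0E; ring.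
Qed.

Lemma triangle_comb (x : E) : triangle a x -> exists c : 'I_3 -> R,
  [/\ forall i, 0 <= c i, c 0 + c 1 + c 2 = 1 & x = c 0 *: a 0 + c 1 *: a 1 + c 2 *: a 2].
Proof. by move=> [c [c_ge0 + ->]]; rewrite !sum_I3 => c1; exists c. Qed.

(** Division by one edge equation at a time: in the interior of an edge the barycentric coordinates
    already split off are nonzero, so the quotient vanishes there and can be divided again. *)
Lemma bubble_factor p m : (msize p <= m.+3)%N -> (forall e, 'r_ e p = 0) ->
  exists2 q, (msize q <= m)%N & p = lam 0 * lam 1 * lam 2 * q.
Proof.
move=> sp h.
have S0 : ordS (0 : 'I_3) = 1 by apply/val_inj.
have S1 : ordS (1 : 'I_3) = 2 by apply/val_inj.
have S2 : ordS (2 : 'I_3) = 0 by apply/val_inj.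
have P1 : ord_pred (1 : 'I_3) = 0 by apply/val_inj.
have P2 : ord_pred (2 : 'I_3) = 1 by apply/val_inj.
have z e s : ev o p (a (ordS e) + s *: edge_vec a e) = 0.
  by rewrite -horner_restr h horner0.
have x1 s : a (ordS 1) + s *: edge_vec a 1 = s *: a 0 + 0 *: a 1 + (1 - s) *: a 2.
  by apply/matrixP => i j; rewrite /edge_vec S1 P1 !mxE; ring.
have x2 s : a (ordS 2) + s *: edge_vec a 2 = (1 - s) *: a 0 + s *: a 1 + 0 *: a 2.
  by apply/matrixP => i j; rewrite /edge_vec S2 P2 !mxE; ring.
have ev1 e s : ev o (lam e) (a (ordS 1) + s *: edge_vec a 1) = if e == 0 then s else if e == 1 then 0 else 1 - s.
  by rewrite x1 (@ev_lam e (fun i => if i == 0 then s else if i == 1 then 0 else 1 - s)) //=; ring.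
have ev2 e s : ev o (lam e) (a (ordS 2) + s *: edge_vec a 2) = if e == 0 then 1 - s else if e == 1 then s else 0.
  by rewrite x2 (@ev_lam e (fun i => if i == 0 then 1 - s else if i == 1 then s else 0)) //=; ring.
have [p1 sp1 pE] := framecrd_dvd (noncollinear_edge nc 0) sp (fun s _ => z 0 s).
have [p2 sp2 p1E] : exists2 p2, (msize p2 <= m.+1)%N & p1 = lam 1 * p2.
  apply: (framecrd_dvd (noncollinear_edge nc 1) sp1) => s /andP[s0 s1].
  have := z 1 s; rewrite pE evM -/(lam 0) ev1 /= => /eqP.
  by rewrite mulf_eq0 gt_eqF //= => /eqP.
have [p3 sp3 p2E] : exists2 p3, (msize p3 <= m)%N & p2 = lam 2 * p3.
  apply: (framecrd_dvd (noncollinear_edge nc 2) sp2) => s /andP[s0 s1].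
  have := z 2 s; rewrite pE p1E !evM -/(lam 0) !ev2 /= => /eqP.
  by rewrite !mulf_eq0 subr_eq0 (gt_eqF s1) (gt_eqF s0) /= => /eqP.
by exists p3 => //; rewrite pE p1E p2E -/(lam 0) !mulrA.
Qed.

Lemma lam_neq0 e : lam e != 0.
Proof.
apply/eqP => l0; pose c (i : 'I_3) : R := (i == e)%:R.
have c1 : c 0 + c 1 + c 2 = 1 by rewrite /c; case: (I3_cases e) => -> /=; rewrite ?addr0 ?add0r.
by have /esym/eqP := ev_lam e c1; rewrite l0 ev0 /c eqxx oner_eq0.
Qed.

Lemma symcurl_bubble_eq0 l w0 w1 : (2 <= l)%N -> (msize w0 <= l.+2)%N -> (msize w1 <= l.+2)%N ->
  (forall e, 'r_ e w0 = 0 /\ 'r_ e w1 = 0) ->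
  (forall p0 p1, (msize p0 <= (l - 2).+1)%N -> (msize p1 <= (l - 2).+1)%N ->
     ip_triangle a (symcurl o w0 w1) (symperp o p0 p1) = 0) ->
  w0 = 0 /\ w1 = 0.
Proof.
move=> l2 s0 s1 h ip0.
have lE : l.+2 = (l - 2).+1.+3 by lia.
rewrite lE in s0 s1.
have [z0 sz0 w0E] := bubble_factor s0 (fun e => proj1 (h e)).
have [z1 sz1 w1E] := bubble_factor s1 (fun e => proj2 (h e)).
have [p0 [p1 [sp0 sp1 r0 r1]]] := rot_symperp_surj o sz0 sz1.
have := ip0 _ _ sp0 sp1; rewrite /symcurl /symperp ip_triangleE (div_symcurl o) r0 r1.
rewrite (tri_intD _ nc) (tri_int_div_eq0 nc) ?add0r => [I0|e d]; last first.
  have [h0 h1] := h e.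
  by rewrite restrB !restrM restrD -scaleN1r restrZ restrD !restrM h0 h1 !mul0r !addr0 scaler0 !mulr0 subr0 -(scale0r 0) int01Z mul0r.
pose B := lam 0 * lam 1 * lam 2.
(* The pairing is, up to sign, the integral of the bubble times (z0^2 + z1^2) / 2, the 1/2 coming
   from the symmetrized test field; on the triangle the barycentric coordinates are nonnegative, so
   the integrand has a sign. *)
have Z0 : mpolyC 2 2^-1 * (B * (z0 * z0 + z1 * z1)) = 0.
  apply: (tri_int_ge0_eq0 nc (o := o)) => [x /triangle_comb[c [c0 c1 ->]]|].
    rewrite /B !evM (evD o (z0 * z0)) !evM evC !(ev_lam _ c1) -!expr2.
    by rewrite !mulr_ge0 ?invr_ge0 ?addr_ge0 ?sqr_ge0.
  rewrite -[LHS]addr0 -I0 -(tri_intD _ nc).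
  have -> : mpolyC 2 2^-1 * (B * (z0 * z0 + z1 * z1)) + (w0 * - (2^-1 *: z0) + w1 * - (2^-1 *: z1)) = 0.
    by rewrite w0E w1E -!mul_mpolyC /B; ring.
  have e := tri_intD o nc 0 0; rewrite addr0 in e.
  by rewrite I0; apply: (@addrI _ (tri_int a o 0)); rewrite -e [RHS]addr0.
have : z0 * z0 + z1 * z1 = 0.
  move/eqP: Z0; rewrite !mulf_eq0 !(negbTE (lam_neq0 _)) /= mpolyC_eq0 invr_eq0 pnatr_eq0 /=.
  by move/eqP.
move=> zz; suff [z00 z10] : z0 = 0 /\ z1 = 0 by rewrite w0E w1E z00 z10 !mulr0.
have zx x : ev o z0 x = 0 /\ ev o z1 x = 0.
  have := congr1 (fun p => ev o p x) zz; rewrite evD !evM ev0 -!expr2 => /eqP.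
  by rewrite paddr_eq0 ?sqr_ge0 // !sqrf_eq0 => /andP[/eqP -> /eqP ->].
by split; apply: (@ev_eq0 _ o) => x; have [] := zx x.
Qed.

End Unisolvence.

Theorem lemma3p8 (R : realType) (a : 'I_3 -> 'cV[R]_2) (o : 'cV[R]_2)
    (n : 'I_3 -> 'cV[R]_2) (k l : nat) :
  noncollinear a ->
  triangle a o ->
  (forall e, outward_unit_normal a e (n e)) ->
  (3 <= k)%N ->
  (k - 1 <= l)%N ->
  [/\ direct_sum (Cspace l) (Ccompl o k),
      direct_sum (hessP (k - 2)) (symperpP o (l - 2)),
      exists (dSigma d1 : nat) (d2 d3 : 'I_3 -> nat) (d4 : nat),
        [/\ has_dim (Sigma o l k) dSigma,
            has_dim (@Symmetric R) d1,
            forall e, has_dim (polys_on (edge a e) (l - 2)) (d2 e) /\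
                      has_dim (polys_on (edge a e) (l - 1)) (d3 e),
            has_dim (sum_space (hessP (k - 2)) (symperpP o (l - 2))) d4
          & (\sum_(v < 3) d1 + \sum_(e < 3) d2 e + \sum_(e < 3) d3 e + d4
             = dSigma)%N]
    & forall tau, Sigma o l k tau ->
        (forall v : 'I_3, tau (a v) = 0) ->
        (forall (e : 'I_3) q, polys_on (edge a e) (l - 2) q ->
           ip_edge a e (nn_trace (n e) tau) q = 0) ->
        (forall (e : 'I_3) q, polys_on (edge a e) (l - 1) q ->
           ip_edge a e (edge_trace (n e) tau) q = 0) ->
        (forall sigma,
           sum_space (hessP (k - 2)) (symperpP o (l - 2)) sigma ->
           ip_triangle a tau sigma = 0) ->
        tau = 0].
Proof.
move=> nc _ nP k3 kl.
have l2 : (2 <= l)%N by lia.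
have kE : (k - 2 = (k - 3).+1)%N by lia.
have kE' : (k - 2).+1 = k.-1 by lia.
split.
- exact: direct_sum_Cspace.
- exact: direct_sum_hessP.
- exists (size (rem (mnm1 (0%R : 'I_2)) (monomials 1 l.+1)) + size (monomials 1 l.+1)
      + size (monomials 0 k.-1))%N, 3%N, (fun _ => (l - 2).+1), (fun _ => (l - 1).+1),
    (size (monomials 2 (k - 3)) + (size (monomials 0 (l - 2).+1) + size (monomials 0 (l - 2).+1)))%N.
  split.
  + apply: has_dim_direct_sum; [exact: has_dim_Cspace|exact/has_dim_Ccompl/(leq_trans _ k3)|].
    exact: direct_sum_Cspace.
  + exact: has_dim_Symmetric.
  + by move=> e; split; exact: has_dim_polys_on.
  + apply: has_dim_direct_sum; [by rewrite kE; exact: has_dim_hessP|exact: has_dim_symperpP|].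
    exact: direct_sum_hessP.
  + exact: dimension_count.
move=> tau [t1 + [t2 + <-]].
rewrite (CspaceE o) CcomplE => -[v0 [v1 [sv0 sv1 ->]]] [q /= sq <-].
rewrite kE' in sq.
rewrite evSD => vert nn et ip.
have hess0' p : (msize p <= k.-1)%N -> hessP (k - 2) (hess o p).
  by move=> sp; rewrite (hessPE o); exists p; rewrite //= kE'.
have hess_ip p : (msize p <= k.-1)%N -> tri_int a o (frobM
    (mderiv 1 v0 + q * mpolyX R (mnm1 0) * mpolyX R (mnm1 0))
    (2^-1 *: (mderiv 1 v1 - mderiv 0 v0) + q * mpolyX R (mnm1 0) * mpolyX R (mnm1 1))
    (- mderiv 0 v1 + q * mpolyX R (mnm1 1) * mpolyX R (mnm1 1))
    (mderiv 0 (mderiv 0 p)) (mderiv 0 (mderiv 1 p)) (mderiv 1 (mderiv 1 p))) = 0.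
  move=> sp; rewrite -ip_triangleE; apply: ip; exists (hess o p); first exact: hess0'.
  by exists 0; rewrite ?addr0 // symperpPE; exists 0, 0; rewrite !msize0 symperp0.
have q0 := radial_part_eq0 nc nP k3 kl sv0 sv1 sq vert nn et hess_ip.
have [w0 [w1 [sw0 sw1 vw hw]]] := rigid_normalisation nc nP k3 kl sv0 sv1 sq vert nn et hess_ip.
(* With [q = 0] and v replaced by its normalisation w, only the tests in [symperpP] remain to be
   used. *)
have tauE : evS o (mderiv 1 v0 + q * mpolyX R (mnm1 0) * mpolyX R (mnm1 0))
    (2^-1 *: (mderiv 1 v1 - mderiv 0 v0) + q * mpolyX R (mnm1 0) * mpolyX R (mnm1 1))
    (- mderiv 0 v1 + q * mpolyX R (mnm1 1) * mpolyX R (mnm1 1)) = symcurl o w0 w1.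
  by rewrite -vw q0 !mul0r !addr0.
rewrite tauE in ip *.
have [-> ->] : w0 = 0 /\ w1 = 0.
  apply: (symcurl_bubble_eq0 nc l2 sw0 sw1 hw) => p0 p1 sp0 sp1; apply: ip.
  exists 0; first by rewrite (hessPE o); exists 0; rewrite /= ?msize0 ?hess0.
  by exists (symperp o p0 p1); rewrite ?add0r // symperpPE; exists p0, p1.
exact: symcurl0.
Qed.
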